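(* Let $p$ be a prime number and let $\gamma\in\mathbb{F}_p^*$ be an element of multiplicative order at least $\exp(\Omega(\log p/\log\log p))$. Let $\varepsilon_j$ be independent random variables distributed uniformly on $\{\gamma^{-1},\gamma\}$. Consider the lazy Markov chain $0\neq X_0,X_1,\dots,X_n,\dots$ defined by $$X_{j+1}=\begin{cases} f_*(X_j)\cdot\varepsilon_{j+1} & \text{with probability } 1/2,\\ X_j & \text{with probability } 1/2.\end{cases}$$ Then for an arbitrary $c>0$ and for any $n=c\exp(\log p/\log\log p)$ one has $$\|P_n-U\|:=\frac12\max_{A\subseteq\mathbb{F}_p^*}\left|\mathrm{P}(X_n\in A)-\frac{|A|}{p-1}\right|\le e^{-O(c)}.$$ The same is true for the chain $X_{j+1}=f_*(X_j)\cdot\varepsilon_{j+1}$, where now the $\varepsilon_j$ denote independent random variables distributed uniformly on $\{1,\gamma^{-1},\gamma\}$.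
   Context: $\mathbb{F}_p=\mathbb{Z}/p\mathbb{Z}$ and $\mathbb{F}_p^*=\mathbb{F}_p\setminus\{0\}$. For fixed nonzero $\alpha,\beta\in\mathbb{F}_p$, the bijection $f_*=f_*^{\alpha,\beta}$ of $\mathbb{F}_p^*$ is defined by $f_*(x)=\frac{x}{\alpha x+\beta}$ for $x\neq-\beta/\alpha$ and $f_*(-\beta/\alpha)=1/\alpha$; the result does not depend on the particular choice of $(\alpha,\beta)$, and one can take, say, $\alpha=1$, $\beta=-1$. $P_n$ denotes the distribution of $X_n$ and $U$ the uniform distribution on $\mathbb{F}_p^*$. All logarithms are to base $2$. $O(\cdot)$ and $\Omega(\cdot)$ are the usual asymptotic symbols with absolute constants. *)

(* Defs.v *)
From HB Require Import structures.
From mathcomp Require Import all_boot all_order all_algebra all_fingroup.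
From mathcomp Require Import all_classical all_reals all_analysis.

Set Implicit Arguments.
Unset Strict Implicit.
Unset Printing Implicit Defensive.

Import Order.TTheory GRing.Theory Num.Theory.

Local Open Scope classical_set_scope.
Local Open Scope ring_scope.

Definition log2 (R : realType) (x : R) : R := ln x / ln 2.

(* For p = 2 the denominator is 0 and the value is the dummy 0. *)
Definition log_ratio (R : realType) (p : nat) : R :=
  log2 (p%:R : R) / log2 (log2 (p%:R : R)).

Definition fstar (F : fieldType) (alpha beta x : F) : F :=
  if x == - beta / alpha then alpha^-1 else x / (alpha * x + beta).

Section Probability.
Context (R : realType) (d : measure_display) (T : measurableType d).
Variable P : probability T R.

(* Random variables with values in a finite type, which carries no canonical
   sigma-algebra: every fibre is required to be an event. *)
Definition discrete_rv (V : finType) (Y : T -> V) : Prop :=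
  forall v, measurable (Y @^-1` [set v]).

Definition uniform_on (V : finType) (S : {set V}) (Y : T -> V) : Prop :=
  forall v, P (Y @^-1` [set v]) = ((v \in S)%:R / #|S|%:R)%:E.

Definition events_of (V : finType) (Y : T -> V) : set (set T) :=
  [set Y @^-1` B | B in [set: set V]].

(* The random variables of a family need not share their value type, hence
   independence is phrased on the families of events they generate. *)
Definition mutually_independent (I : eqType) (F : I -> set (set T)) : Prop :=
  forall (s : seq I) (E : I -> set T), uniq s ->
    (forall i, i \in s -> F i (E i)) ->
    P (\bigcap_(i in [set` s]) E i) = (\prod_(i <- s) P (E i))%E.

Definition tv_unif (p : nat) (Y : T -> 'F_p) : R :=
  2^-1 * \big[Num.max/0]_(A : {set 'F_p} | A \subset [set~ 0]%SET)
           `| fine (P (Y @^-1` [set` A])) - #|A|%:R / p.-1%:R |.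

(* eps j and coin j are the noise of the step from X j to X j.+1, that is,
   eps j stands for the variable usually numbered j+1; the law of X 0 on the
   nonzero elements is arbitrary. *)

Definition lazy_noise (p : nat) (X0 : T -> 'F_p) (eps : nat -> T -> 'F_p)
    (coin : nat -> T -> bool) (i : option (nat + nat)) : set (set T) :=
  match i with
  | None => events_of X0
  | Some (inl j) => events_of (eps j)
  | Some (inr j) => events_of (coin j)
  end.

Record lazy_chain (p : nat) (alpha beta gamma : 'F_p)
    (X : nat -> T -> 'F_p) (eps : nat -> T -> 'F_p)
    (coin : nat -> T -> bool) : Prop := LazyChain {
  lazy_X0_rv : discrete_rv (X 0%N);
  lazy_eps_rv : forall j, discrete_rv (eps j);
  lazy_coin_rv : forall j, discrete_rv (coin j);
  lazy_X0_neq0 : forall w, X 0%N w != 0;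
  lazy_eps_unif : forall j, uniform_on [set gamma^-1; gamma]%SET (eps j);
  lazy_coin_unif : forall j, uniform_on [set: bool]%SET (coin j);
  lazy_indep : mutually_independent (lazy_noise (X 0%N) eps coin);
  lazy_step : forall j w,
    X j.+1 w = if coin j w then fstar alpha beta (X j w) * eps j w else X j w
}.

Definition three_noise (p : nat) (X0 : T -> 'F_p) (eps : nat -> T -> 'F_p)
    (i : option nat) : set (set T) :=
  match i with
  | None => events_of X0
  | Some j => events_of (eps j)
  end.

Record three_chain (p : nat) (alpha beta gamma : 'F_p)
    (X : nat -> T -> 'F_p) (eps : nat -> T -> 'F_p) : Prop := ThreeChain {
  three_X0_rv : discrete_rv (X 0%N);
  three_eps_rv : forall j, discrete_rv (eps j);
  three_X0_neq0 : forall w, X 0%N w != 0;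
  three_eps_unif : forall j, uniform_on [set 1; gamma^-1; gamma]%SET (eps j);
  three_indep : mutually_independent (three_noise (X 0%N) eps);
  three_step : forall j w, X j.+1 w = fstar alpha beta (X j w) * eps j w
}.

End Probability.

(* Main.v *)
Require Import Defs.
From HB Require Import structures.
From mathcomp Require Import all_boot all_order all_algebra all_fingroup.
From mathcomp Require Import all_classical all_reals all_analysis.
From mathcomp Require Import cyclic zify ring lra.

(** In the coordinate y = 1/x the map f_* becomes the affine map
    y |-> alpha + beta * y with the point 0 cut out of its orbit, so each chain
    alternates an affine permutation with dilations by gamma and gamma^-1.

    A mean-zero function h that the chain hardly contracts is almost invariant
    under the dilation by gamma^2, and the same holds for h \o f_*
    ([lazy_op_contraction], [three_op_contraction]).  In the coordinate y these
    are homotheties about two different centres.  Combining them, h is almost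
    invariant under the translations tau_i = alpha * (1 - g^i) with
    g = gamma^-2, at a cost that grows linearly in i.  At the frequency
    xi, the increment of a function under the translation by tau has Fourier
    mass 2 * (1 - cos (2 pi xi tau / p)) times that of the function.  Hence h is
    almost constant, therefore almost zero, as soon as every nonzero frequency
    xi has some i <= M with xi * tau_i / p at distance at least 1/(2Q) from the
    integers ([some_frequency_far]).  The outcome is the Poincare inequality
    [normsq_le_dilation_energy], whose constant is polynomial in Q and M.

    The arithmetic core is [no_small_geometric_sequence].  If some frequency failed,
    differences of centered residues would give a sequence of integers u_j,
    bounded by p/Q, which modulo p is a geometric progression of ratio g.  Its
    r x r Hankel blocks have rank one modulo p, so their determinants are
    divisible by p^(r-1); these are also at most r! (p/Q)^r in absolute value,
    so they vanish when r! p < Q^r.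
    The Hankel matrix then has rank below r over the integers, hence modulo 3,
    and among 3^r + 1 of its columns two coincide modulo 3.  One third of the
    difference of these columns is again an integer sequence which is geometric
    of ratio g modulo p; it is nonzero modulo p because g has order larger than
    3^r, and its size has dropped by the factor 2/3.  After O(log p) rounds the
    integers are smaller than 1 in absolute value, so they are 0, although they
    are nonzero modulo p.

    Let L be [log_ratio p], so that (log2 p)^L = p.  With Q close to r (log2 p)^k
    the condition r! p < Q^r only asks for r > L/k, and M is about (log p) 3^r.
    For k large, 3^r is below the order of gamma^2 and the Poincare constant is
    at most exp (L/2) times a power of log p ([walk_parameters]).  Then
    c * exp L steps gain a factor exp (-2c)/p on the squared L^2 norm, which
    absorbs the passage from L^2 to total variation, and kappa = 1 works. *)

Set Implicit Arguments.
Unset Strict Implicit.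
Unset Printing Implicit Defensive.

Import Order.TTheory GRing.Theory Num.Theory.

Local Open Scope ring_scope.

(** * Integer sequences that are geometric modulo p *)

(** A matrix of rank at least r has r independent rows, and these have r
    independent columns. *)
Lemma rank_lt_of_minors_eq0 (F : fieldType) (m n r : nat) (A : 'M[F]_(m, n)) :
  (forall (f : 'I_r -> 'I_m) (g : 'I_r -> 'I_n), \det (mxsub f g A) = 0) ->
  (\rank A < r)%N.
Proof.
move=> minors0; rewrite ltnNge; apply/negP => le_r.
pose h := widen_ord le_r.
have [C HC] := row_freeP (maxrowsub_free A).
pose S : 'M[F]_(r, \rank A) := rowsub h 1%:M.
have HS : S *m S^T = 1%:M.
  apply/matrixP => i j; rewrite !mxE (bigD1 (h i)) //= big1 ?addr0.
    by rewrite !mxE eqxx mul1r -!val_eqE /= eq_sym.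
  by move=> k /negPf; rewrite !mxE eq_sym => ->; rewrite mul0r.
pose f i := maxrankfun A (h i).
have freeB : row_free (rowsub f A).
  apply/row_freeP; exists (C *m S^T).
  have -> : rowsub f A = S *m rowsub (maxrankfun A) A.
    by rewrite -rowsubE -mxsub_comp.
  by rewrite mulmxA -(mulmxA S) HC mulmx1.
have fullB : row_full (rowsub f A)^T.
  by rewrite /row_full mxrank_tr; move: freeB; rewrite /row_free.
have := fullrowsub_unit fullB.
rewrite unitmxE -trmx_mxsub det_tr -mxsub_comp.
by rewrite (minors0 f (fullrankfun fullB)) unitr0.
Qed.

(** In a rank factorization the columns are determined by vectors of length
    [\rank A], of which there are only [#|F| ^ \rank A]. *)
Lemma col_eq_of_rank_lt (F : finFieldType) (m n : nat) (A : 'M[F]_(m, n)) :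
  (#|F| ^ \rank A < n)%N ->
  exists a b : 'I_n, (a < b)%N /\ col a A = col b A.
Proof.
move=> lt_n.
pose c (j : 'I_n) : 'cV[F]_(\rank A) := col j (row_base A).
have cE j : col j A = col_base A *m c j.
  by rewrite /c !colE mulmxA mulmx_base.
have /injectivePn [a [b ab cab]] : ~~ injectiveb c.
  apply/injectiveP => /leq_card; rewrite card_ord card_mx muln1 => le_n.
  by move: lt_n; rewrite ltnNge le_n.
wlog lt_ab : a b ab cab / (a < b)%N.
  move=> H; move: (ab); rewrite -val_eqE neq_ltn => /orP[] lt_ab; first exact: (H a b).
  by apply: (H b a) => //; rewrite eq_sym.
by exists a, b; split=> //; rewrite !cE cab.
Qed.

(** Modulo q the matrix has rank at most one.  Column operations clear all
    columns but one modulo q, so each of the other n columns contributes a factor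
    q to the determinant. *)
Lemma dvdz_det_of_proportional_cols (q : int) (n : nat) (A : 'M[int]_(1 + n))
    (t : 'rV[int]_n) :
  (forall i j, (q %| A i (rshift 1 j) - A i (lshift n ord0) * t ord0 j)%Z) ->
  (q ^+ n %| \det A)%Z.
Proof.
move=> dvdA.
pose B : 'M[int]_(1 + n, n) :=
  \matrix_(i, j) ((A i (rshift 1 j) - A i (lshift n ord0) * t ord0 j) %/ q)%Z.
have eqA : A *m block_mx 1%:M (- t) 0 1%:M
         = row_mx (lsubmx A) B *m block_mx 1%:M 0 0 q%:M.
  rewrite -{1}(hsubmxK A) !mul_row_block !mulmx1 !mulmx0 !addr0 add0r.
  congr row_mx; rewrite mul_mx_scalar; apply/matrixP => i j; rewrite !mxE big_ord1 !mxE.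
  by rewrite [RHS]mulrC (divzK (dvdA i j)) mulrN addrC.
have := congr1 (fun M => \det M) eqA.
rewrite !det_mulmx !det_ublock !det1 !mul1r mulr1 det_scalar => ->.
exact: dvdz_mull.
Qed.

Lemma normr_det_le (R : numDomainType) (n : nat) (A : 'M[R]_n) (b : R) :
  (forall i j, `|A i j| <= b) -> `|\det A| <= n`!%:R * b ^+ n.
Proof.
move=> leb; rewrite /determinant; apply: le_trans (ler_norm_sum _ _ _) _.
have -> : n`!%:R * b ^+ n = \sum_(s : 'S_n) b ^+ n.
  by rewrite sumr_const card_Sn mulr_natl.
apply: ler_sum => s _; rewrite normrM normrX normrN1 expr1n mul1r normr_prod.
apply: (@le_trans _ _ (\prod_(i < n) b)).
  by apply: ler_prod => i _; rewrite normr_ge0 /=; exact: leb.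
by rewrite prodr_const card_ord.
Qed.

Section GeometricModP.
Variables (p : nat) (p_pr : prime p).

Lemma Fp_lift (x : 'F_p) : ((x : nat)%:Z)%:~R = x.
Proof. by rewrite -[RHS]natr_Zp. Qed.

Lemma Fp_intr_eq0 (z : int) : (z%:~R == 0 :> 'F_p) = (p %| z)%Z.
Proof. by rewrite (dvdz_pcharf (pchar_Fp p_pr)). Qed.

Variables (g : 'F_p) (g_neq0 : g != 0).

(** The minor is divisible by p^(r-1) and bounded by r! (p/Q)^r, which is less
    than p^(r-1). *)
Lemma minor_of_geometric_eq0 (Q r : nat) (xi : 'F_p) (u : nat -> int)
    (f c : 'I_r -> nat) :
  (r`! * p < Q ^ r)%N ->
  (forall i j, (u (f i + c j)%N)%:~R = xi * g ^+ (f i + c j)) ->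
  (forall i j, `|u (f i + c j)%N| * Q%:Z <= p%:Z) ->
  \det (\matrix_(i, j) u (f i + c j)%N) = 0.
Proof.
have p_gt0 := prime_gt0 p_pr.
case: r f c => [|r] f c ltQ uE uQ.
  by move: ltQ; rewrite fact0 mul1n expn0 ltnS leqn0 eqn0Ngt p_gt0.
set A : 'M[int]_(1 + r) := \matrix_(i, j) _.
pose t : 'rV[int]_r :=
  \row_j ((g ^+ c (rshift 1 j) / g ^+ c (@lshift 1 r ord0) : 'F_p) : nat)%:Z.
have dvd_det : ((p%:Z) ^+ r %| \det A)%Z.
  apply: (@dvdz_det_of_proportional_cols _ r A t) => i j.
  rewrite -Fp_intr_eq0 !mxE intrB intrM Fp_lift !uE !exprD subr_eq0.
  have := expf_neq0 (c (@lshift 1 r ord0)) g_neq0.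
  move: (g ^+ _) (g ^+ _) (g ^+ _) => x y z z_neq0.
  by apply/eqP; field.
have Q_gt0 : (0 < Q)%N.
  by case: (Q) ltQ => //; rewrite exp0n.
apply/eqP; apply: contraLR ltQ => det_neq0; rewrite -leqNgt.
have le_det : (p ^ r <= `|\det A|)%N.
  apply: dvdn_leq; first by rewrite absz_gt0.
  by move: dvd_det; rewrite dvdzE abszX.
pose B := (p %/ Q)%N.
have det_le : (`|\det A| <= (r.+1)`! * B ^ r.+1)%N.
  rewrite -lez_nat PoszM abszE -[Posz _`!]natz.
  have -> : Posz (B ^ r.+1) = (B%:Z) ^+ r.+1 by rewrite -!natz natrX.
  apply: normr_det_le => i j.
  by rewrite mxE -abszE lez_nat leq_divRL // -lez_nat PoszM abszE uQ.
have : (p ^ r * Q ^ r.+1 <= p ^ r * (r.+1`! * p))%N.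
  rewrite mulnCA -expnSr.
  apply: leq_trans (leq_mul (leq_trans le_det det_le) (leqnn _)) _.
  by rewrite -mulnA leq_mul2l -expnMn leq_exp2r // leq_divM orbT.
by rewrite leq_pmul2l // expn_gt0 p_gt0.
Qed.

(** The vanishing of the integer minors bounds the rank of the Hankel matrix
    reduced modulo 3.  The modulus 3 is the smallest integer exceeding 2, the
    number of terms in a difference: this is what makes the sequence shrink in
    [no_small_geometric_sequence]. *)
Lemma geometric_shift_cong3 (Q r len : nat) (xi : 'F_p) (u : nat -> int) :
  (r`! * p < Q ^ r)%N ->
  (forall j, (j <= len + 3 ^ r)%N -> (u j)%:~R = xi * g ^+ j) ->
  (forall j, (j <= len + 3 ^ r)%N -> `|u j| * Q%:Z <= p%:Z) ->
  exists a b, [/\ (a < b)%N, (b <= 3 ^ r)%N &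
    forall j, (j <= len)%N -> (3 %| u (j + b)%N - u (j + a)%N)%Z].
Proof.
move=> ltQ uE uQ.
pose A : 'M['F_3]_(len.+1, (3 ^ r).+1) := \matrix_(i, j) (u (i + j)%N)%:~R.
have le_len (i : 'I_len.+1) (j : 'I_(3 ^ r).+1) : (i + j <= len + 3 ^ r)%N.
  by rewrite leq_add // -ltnS.
have rkA : (\rank A < r)%N.
  apply: rank_lt_of_minors_eq0 => f c.
  pose H : 'M[int]_r := \matrix_(i, j) u (f i + c j)%N.
  have -> : mxsub f c A = map_mx intr H by apply/matrixP => i j; rewrite !mxE.
  rewrite det_map_mx (minor_of_geometric_eq0 (Q := Q) (xi := xi)) ?rmorph0 //.
  - by move=> i j; apply: uE.
  - by move=> i j; apply: uQ.
have [|a [b [ab /colP eq_ab]]] := @col_eq_of_rank_lt _ _ _ A.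
  by rewrite card_Fp // ltnS leq_exp2l // ltnW.
exists (a : nat), (b : nat); split=> //; first by rewrite -ltnS.
move=> j le_j; have := eq_ab (Ordinal (le_j : (j < len.+1)%N)).
rewrite !mxE /= => eq_u.
by rewrite (dvdz_pcharf (pchar_Fp (isT : prime 3))) rmorphB /= eq_u subrr.
Qed.

(** Passing from u to one third of a difference of two shifts preserves all the
    hypotheses, shortens u by 3^r, and multiplies the bound by 2/3.  With no
    round left, u_0 is an integer of absolute value less than 1 whose residue xi
    is nonzero. *)
Lemma no_small_geometric_sequence (Q r N : nat) (xi : 'F_p) (u : nat -> int) :
  (3 < p)%N -> (r`! * p < Q ^ r)%N ->
  (forall d, (0 < d)%N -> (d <= 3 ^ r)%N -> g ^+ d != 1) -> xi != 0 ->
  (forall j, (j <= N * 3 ^ r)%N -> (u j)%:~R = xi * g ^+ j) ->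
  (forall j, (j <= N * 3 ^ r)%N -> `|u j| * Q%:Z <= p%:Z) ->
  (forall j, (j <= N * 3 ^ r)%N -> `|u j| * 2 ^+ N < 3 ^+ N) ->
  False.
Proof.
move=> p_gt3 ltQ ord_g.
elim: N xi u => [|N IHN] xi u xi0 uE uQ u_lt.
  have := u_lt 0%N isT; rewrite !expr0 mulr1 => u0_lt1.
  have /eqP u0 : u 0%N == 0 by lia.
  by have := uE 0%N isT; rewrite u0 expr0 mulr1 => /esym/eqP; apply/negP.
have eqN : (N.+1 * 3 ^ r = N * 3 ^ r + 3 ^ r)%N by rewrite mulSn addnC.
rewrite eqN in uE uQ u_lt.
have [a [b [lt_ab le_b dvd3]]] := geometric_shift_cong3 ltQ uE uQ.
pose v j := ((u (j + b)%N - u (j + a)%N) %/ 3)%Z.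
have vE j : (j <= N * 3 ^ r)%N -> v j * 3 = u (j + b)%N - u (j + a)%N.
  by move=> le_j; rewrite divzK // dvd3.
have ja j : (j <= N * 3 ^ r)%N -> (j + a <= N * 3 ^ r + 3 ^ r)%N by lia.
have jb j : (j <= N * 3 ^ r)%N -> (j + b <= N * 3 ^ r + 3 ^ r)%N by lia.
have three0 : (3 : 'F_p) != 0.
  rewrite -[3]/((3%:Z)%:~R) Fp_intr_eq0; apply: contraTN p_gt3.
  by rewrite -leqNgt => /dvdn_leq; apply.
apply: (IHN (xi * g ^+ a * (g ^+ (b - a) - 1) / 3) v).
- rewrite !mulf_neq0 ?expf_neq0 ?invr_eq0 // subr_eq0 ord_g ?subn_gt0 //.
  exact: leq_trans (leq_subr _ _) le_b.
- move=> j le_j; apply: (mulIf three0).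
  have := congr1 (fun z : int => z%:~R : 'F_p) (vE j le_j).
  rewrite intrM intrB !uE ?ja ?jb // => ->.
  rewrite [RHS]mulrAC mulfVK //.
  rewrite -{1}(subnKC (ltnW lt_ab)) !exprD; ring.
- move=> j le_j; have := uQ _ (ja j le_j); have := uQ _ (jb j le_j).
  have := vE j le_j; move: (u _) (u _) (v j) => x y z; nia.
- move=> j le_j; have := u_lt _ (ja j le_j); have := u_lt _ (jb j le_j).
  have := vE j le_j; rewrite !exprS.
  have : (0 : int) < 2 ^+ N by rewrite exprn_gt0.
  move: (u _) (u _) (v j) (2 ^+ N) (3 ^+ N) => x y z s t; nia.
Qed.

End GeometricModP.

(** * Additive characters of F_p in real form *)

(** Doubling the angle multiplies 1 - cos by at most 4, and for an angle between
    a quarter and a half turn the cosine is nonpositive. *)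
Lemma one_sub_cos_doubling (R : realType) (s : nat) (x : R) :
  0 <= x -> x <= 2^-1 -> 1 <= 4 * (2 ^+ s * x) ->
  1 <= 4 ^+ s * (1 - cos (pi *+ 2 * x)).
Proof.
have pi0 := pi_ge0 R.
have base (y : R) : 0 <= y -> y <= 2^-1 -> 1 <= 4 * y -> 1 <= 1 - cos (pi *+ 2 * y).
  move=> y0 y2 y4; rewrite lerBrDr gerDl // -oppr_ge0.
  have := @cosDpi R (pi *+ 2 * y - pi); rewrite subrK => ->; rewrite opprK.
  by apply: cos_ge0_pihalf; apply/andP; split; nra.
elim: s x => [|s IHs] x x0 x2; first by rewrite !expr0 !mul1r; exact: base.
have [x4 _|x4 h] := leP 1 (4 * x).
  have h := base x x0 x2 x4; apply: le_trans h _.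
  apply: ler_peMl; first by rewrite subr_ge0 cos_le1.
  by apply: exprn_ege1; lra.
have h2 : 1 <= 4 ^+ s * (1 - cos (pi *+ 2 * (x *+ 2))).
  by apply: IHs; [lra|lra|rewrite exprS in h; lra].
apply: le_trans h2 _; rewrite mulrnAr cos_mulr2n.
rewrite (exprSr 4 s) -(mulrA _ 4) ler_pM2l ?exprn_gt0 //.
have := cos_le1 (pi *+ 2 * x); have := cos_geN1 (pi *+ 2 * x).
move: (cos _) => c; nra.
Qed.

Section Characters.
Variables (R : realType) (p : nat) (p_pr : prime p).

Let angle : R := pi *+ 2 / p%:R.
(** The real and imaginary parts of exp (2 pi i x / p). *)
Definition ecos (x : 'F_p) : R := cos (angle * (x : nat)%:R).
Definition esin (x : 'F_p) : R := sin (angle * (x : nat)%:R).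

Let p_neq0 : (p%:R : R) != 0.
Proof. by rewrite pnatr_eq0 -lt0n prime_gt0. Qed.

Lemma angle_nat (m : nat) :
  angle * m%:R = angle * ((m%:R : 'F_p) : nat)%:R + pi *+ 2 *+ (m %/ p).
Proof.
rewrite val_Fp_nat // {1}(divn_eq m p) natrD natrM mulrDr addrC; congr (_ + _).
by rewrite mulrCA mulfVK // mulr_natl.
Qed.

Lemma ecos_nat m : ecos m%:R = cos (angle * m%:R).
Proof. by rewrite angle_nat periodicn //; exact: cosD2pi. Qed.

Lemma esin_nat m : esin m%:R = sin (angle * m%:R).
Proof. by rewrite angle_nat periodicn //; exact: sinD2pi. Qed.

Lemma ecosD x y : ecos (x + y) = ecos x * ecos y - esin x * esin y.
Proof.
rewrite -[x]natr_Zp -[y]natr_Zp -natrD !ecos_nat !esin_nat natrD mulrDr.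
exact: cosD.
Qed.

Lemma esinD x y : esin (x + y) = esin x * ecos y + ecos x * esin y.
Proof.
rewrite -[x]natr_Zp -[y]natr_Zp -natrD !ecos_nat !esin_nat natrD mulrDr.
exact: sinD.
Qed.

Lemma ecos0 : ecos 0 = 1. Proof. by rewrite /ecos mulr0 cos0. Qed.
Lemma esin0 : esin 0 = 0. Proof. by rewrite /esin mulr0 sin0. Qed.

Lemma ecos2Desin2 x : ecos x ^+ 2 + esin x ^+ 2 = 1.
Proof. exact: cos2Dsin2. Qed.

Lemma ecosN x : ecos (- x) = ecos x.
Proof.
have := ecosD x (- x); have := esinD x (- x); have := ecos2Desin2 x.
rewrite subrr ecos0 esin0.
move: (ecos x) (esin x) (ecos (- x)) (esin (- x)) => c s c' s' h1 h2 h3.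
have -> : c' = c' * (c ^+ 2 + s ^+ 2) by rewrite h1 mulr1.
have -> : c' * (c ^+ 2 + s ^+ 2) = c * (c * c' - s * s') + s * (s * c' + c * s').
  by ring.
by rewrite -h2 -h3; ring.
Qed.

Lemma esinN x : esin (- x) = - esin x.
Proof.
have := ecosD x (- x); have := esinD x (- x); have := ecos2Desin2 x.
rewrite subrr ecos0 esin0 ecosN.
move: (ecos x) (esin x) (esin (- x)) => c s s' h1 h2 h3.
have [c0|c0] := eqVneq c 0.
  rewrite c0 in h1 h3; nra.
by apply: (mulfI c0); lra.
Qed.

Lemma ecos_le1 x : ecos x <= 1. Proof. exact: cos_le1. Qed.

(** For s = floor (log2 Q), doubling the angle s times brings it past a quarter
    turn, at the price of a factor 4^s <= Q^2. *)
Lemma one_sub_ecos_ge (Q : nat) (k : int) :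
  2 * `|k| <= p%:Z -> p%:Z < 2 * Q%:Z * `|k| ->
  1 <= Q%:R ^+ 2 * (1 - ecos k%:~R).
Proof.
wlog k_ge0 : k / exists m : nat, k = m%:Z.
  move=> IH; case: (intP k) => [|m|m]; first by apply: IH; exists 0%N.
    by apply: IH; exists m.+1.
  rewrite normrN mulrNz ecosN; apply: IH; by exists m.+1.
have {k_ge0}[m ->] := k_ge0; rewrite ger0_norm // => le_m lt_m.
have Q_gt0 : (0 < Q)%N by lia.
pose s := trunc_log 2 Q.
have /andP[le_s lt_s] := trunc_log_bounds (isT : (1 < 2)%N) Q_gt0.
rewrite -/s in le_s lt_s.
rewrite -[(m%:Z)%:~R]/(m%:R) ecos_nat.
have p_gt0 : (0 : R) < p%:R by rewrite ltr0n prime_gt0.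
have h : 1 <= 4 ^+ s * (1 - cos (pi *+ 2 * (m%:R / p%:R))) :> R.
  apply: one_sub_cos_doubling.
  - by rewrite divr_ge0.
  - rewrite ler_pdivrMr // mulrC ler_pdivlMr // -natrM ler_nat; lia.
  - rewrite !mulrA ler_pdivlMr // mul1r -(natrX _ 2 s) -[4]/(4%:R) -!natrM.
    rewrite ler_nat; move: lt_s; rewrite expnS; nia.
rewrite mulrA -(mulrAC _ p%:R^-1) in h; apply: le_trans h _.
apply: ler_wpM2r; first by rewrite subr_ge0 cos_le1.
by rewrite -[4]/(4%:R) -!natrX ler_nat -(expnM 2 2) mulnC expnM leq_exp2r.
Qed.

End Characters.

(** * Fourier analysis on F_p *)

Section Fourier.
Variables (R : realType) (p : nat) (p_pr : prime p).
Local Notation ecos := (@ecos R p).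
Local Notation esin := (@esin R p).

Lemma ecos1_lt1 : (2 < p)%N -> ecos 1 < 1.
Proof.
move=> p_gt2; rewrite -subr_gt0.
have := @one_sub_ecos_ge R p p_pr p 1.
rewrite -[(1%Z)%:~R]/(1 : 'F_p) => /(_ _ _)/(lt_le_trans ltr01).
by rewrite pmulr_rgt0 ?exprn_gt0 ?ltr0n ?prime_gt0 //; apply; lia.
Qed.

Lemma sum_esin : \sum_x esin x = 0.
Proof.
suff : \sum_x esin x = - \sum_x esin x by lra.
rewrite {1}(reindex_inj (@oppr_inj 'F_p)) /= -sumrN.
by apply: eq_bigr => x _; rewrite esinN.
Qed.

(** The sum of all p-th roots of unity is invariant under a rotation different
    from the identity. *)
Lemma sum_ecos : (2 < p)%N -> \sum_x ecos x = 0.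
Proof.
move=> p_gt2; have lt1 := ecos1_lt1 p_gt2.
have : \sum_x ecos x = (\sum_x ecos x) * ecos 1.
  rewrite {1}(reindex_inj (@addIr 'F_p 1)) /=.
  under eq_bigr do rewrite ecosD //.
  by rewrite sumrB -!mulr_suml sum_esin mul0r subr0.
move/eqP; rewrite -{1}[\sum_x _]mulr1 -subr_eq0 -mulrBr mulf_eq0.
by rewrite (gt_eqF (_ : 0 < 1 - ecos 1)) ?subr_gt0 // orbF => /eqP.
Qed.

Lemma ecos_orthogonality (d : 'F_p) : (2 < p)%N ->
  \sum_xi ecos (xi * d) = p%:R * (d == 0)%:R.
Proof.
move=> p_gt2; have [->|d0] := eqVneq d 0.
  under eq_bigr do rewrite mulr0 ecos0.
  by rewrite sumr_const card_Fp // mulr1.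
by rewrite mulr0 -[RHS]sum_ecos // [RHS](reindex_inj (mulIf d0)).
Qed.

(** The squared modulus of the Fourier coefficient of F at xi. *)
Definition fourier_mass (F : 'F_p -> R) (xi : 'F_p) : R :=
  (\sum_x F x * ecos (xi * x)) ^+ 2 + (\sum_x F x * esin (xi * x)) ^+ 2.

Lemma fourier_mass_ge0 F xi : 0 <= fourier_mass F xi.
Proof. by rewrite addr_ge0 // sqr_ge0. Qed.

Lemma fourier_mass0 F : fourier_mass F 0 = (\sum_x F x) ^+ 2.
Proof.
rewrite /fourier_mass; under eq_bigr do rewrite mul0r ecos0 mulr1.
by rewrite [X in _ + X ^+ 2]big1 ?expr0n ?addr0 // => x _;
  rewrite mul0r esin0 mulr0.
Qed.

Lemma parseval F : (2 < p)%N ->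
  \sum_xi fourier_mass F xi = p%:R * \sum_x F x ^+ 2.
Proof.
move=> p_gt2.
have massE xi : fourier_mass F xi = \sum_x \sum_y F x * F y * ecos (xi * (x - y)).
  rewrite /fourier_mass !expr2 !mulr_suml -big_split /=; apply: eq_bigr => x _.
  rewrite !mulr_sumr -big_split /=; apply: eq_bigr => y _.
  by rewrite mulrBr ecosD // ecosN // esinN //; ring.
under eq_bigr do rewrite massE.
rewrite exchange_big /= mulr_sumr; apply: eq_bigr => x _.
rewrite exchange_big /= (bigD1 x) //= [X in _ + X]big1 ?addr0.
  by rewrite -mulr_sumr ecos_orthogonality // subrr eqxx mulr1 mulrC -expr2.
move=> y yx; rewrite -mulr_sumr ecos_orthogonality // subr_eq0 eq_sym.
by rewrite (negPf yx) !mulr0.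
Qed.

(** The factor is the squared modulus of exp (2 pi i xi tau / p) - 1. *)
Lemma fourier_mass_difference F tau xi :
  fourier_mass (fun x => F (x + tau) - F x) xi
  = 2 * (1 - ecos (xi * tau)) * fourier_mass F xi.
Proof.
have shift (e : 'F_p -> R) :
    \sum_x F (x + tau) * e (xi * x) = \sum_x F x * e (xi * x + - (xi * tau)).
  rewrite [RHS](reindex_inj (addIr tau)) /=; apply: eq_bigr => x _.
  by rewrite mulrDr addrK.
have shiftc : \sum_x F (x + tau) * ecos (xi * x) =
    (\sum_x F x * ecos (xi * x)) * ecos (xi * tau)
    + (\sum_x F x * esin (xi * x)) * esin (xi * tau).
  rewrite shift !mulr_suml -big_split /=; apply: eq_bigr => x _.
  by rewrite ecosD // ecosN // esinN //; ring.
have shifts : \sum_x F (x + tau) * esin (xi * x) =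
    (\sum_x F x * esin (xi * x)) * ecos (xi * tau)
    - (\sum_x F x * ecos (xi * x)) * esin (xi * tau).
  rewrite shift !mulr_suml -sumrB /=; apply: eq_bigr => x _.
  by rewrite esinD // ecosN // esinN //; ring.
rewrite /fourier_mass; under eq_bigr do rewrite mulrBl.
under [X in _ + X ^+ 2]eq_bigr do rewrite mulrBl.
rewrite !sumrB shiftc shifts.
have := ecos2Desin2 R (xi * tau).
move: (\sum_x F x * ecos _) (\sum_x F x * esin _) => C S.
move: (ecos _) (esin _) => c s cs.
have -> : (C * c + S * s - C) ^+ 2 + (S * c - C * s - S) ^+ 2
  = (c ^+ 2 + s ^+ 2 + 1 - 2 * c) * (C ^+ 2 + S ^+ 2) by ring.
by rewrite cs; congr (_ * _); ring.
Qed.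

End Fourier.

(** * Almost invariance under two homotheties *)

(** The triangle inequality for the L^2 norm along the path x, s x, s (s x), ...,
    each step of which costs the same since s preserves the counting measure. *)
Lemma sum_sqr_iter_le (R : realFieldType) (T : finType) (s : T -> T)
    (F : T -> R) (i : nat) : injective s ->
  \sum_x (F (iter i s x) - F x) ^+ 2
  <= i%:R ^+ 2 * \sum_x (F (s x) - F x) ^+ 2.
Proof.
move=> s_inj; elim: i => [|i IHi].
  by rewrite expr0n mul0r big1 // => x _; rewrite subrr expr0n.
set E := \sum_x (F (s x) - F x) ^+ 2 in IHi *.
case: i IHi => [|i] IHi; first by rewrite expr1n mul1r.
set a : R := i.+1%:R in IHi *.
have a_gt0 : 0 < a by rewrite ltr0n.
set D := \sum_x (F (iter i.+1 s x) - F x) ^+ 2 in IHi.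
have -> : i.+2%:R = a + 1 by rewrite /a natr1.
have EE : \sum_x (F (iter i.+1 s (s x)) - F (s x)) ^+ 2 = D.
  by rewrite [RHS](reindex_inj s_inj).
have : a * \sum_x (F (iter i.+2 s x) - F x) ^+ 2 <= (a + 1) * D + a * (a + 1) * E.
  rewrite -EE !mulr_sumr -big_split /=; apply: ler_sum => x _.
  rewrite -[s (s (iter i s x))]/(iter i.+2 s x) (iterSr i.+1 s x).
  rewrite -[s (iter i s (s x))]/(iter i.+1 s (s x)).
  move: (F (iter i.+1 s (s x))) (F (s x)) (F x) => u v w.
  (* (u - w)^2 <= (1 + 1/a)(u - v)^2 + (1 + a)(v - w)^2, multiplied by a *)
  have := sqr_ge0 ((u - v) - a * (v - w)); nra.
nra.
Qed.

Section SpectralGap.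
Variables (R : realType) (p : nat) (p_pr : prime p) (p_gt3 : (3 < p)%N).
Variables (Q r N : nat).
Hypotheses (ltQ : (r`! * p < Q ^ r)%N) (ltN : (p * 2 ^ N < 3 ^ N)%N).
Variables (g : 'F_p) (g_neq0 : g != 0).
Hypothesis ord_g : forall d, (0 < d)%N -> (d <= 3 ^ r)%N -> g ^+ d != 1.

Let Q_gt0 : (0 < Q)%N.
Proof.
case: (posnP Q) ltQ => // ->; case: r => [|r']; last by rewrite exp0n.
by rewrite fact0 mul1n expn0 ltnS leqn0 eqn0Ngt prime_gt0.
Qed.

Lemma centered_lift (x : 'F_p) : exists2 k : int, k%:~R = x & 2 * `|k| <= p%:Z.
Proof.
have lt_p : (x < p)%N by rewrite -[X in (_ < X)%N](Fp_cast p_pr).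
have [le_p|lt_x] := leqP (2 * x) p.
  by exists ((x : nat)%:Z); [exact: Fp_lift | lia].
exists ((x : nat)%:Z - p%:Z); last by lia.
by rewrite intrB Fp_lift -[X in _ - X]/(p%:R) pchar_Fp_0 // subr0.
Qed.

(** If every residue xi b (1 - g^i) had a centered lift of size at most p/(2Q),
    the differences of consecutive lifts would be the sequence excluded by
    [no_small_geometric_sequence], with first residue xi b (g - 1). *)
Lemma some_frequency_far (b xi : 'F_p) : b != 0 -> xi != 0 ->
  exists2 i, (i <= (N * 3 ^ r).+1)%N &
    1 <= Q%:R ^+ 2 * (1 - ecos R (xi * (b * (1 - g ^+ i)))).
Proof.
move=> b0 xi0; apply: contrapT => H.
pose k i := sval (cid2 (centered_lift (xi * (b * (1 - g ^+ i))))).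
have kE i : (k i)%:~R = xi * (b * (1 - g ^+ i)).
  by rewrite /k; case: cid2.
have k_le i : 2 * `|k i| <= p%:Z by rewrite /k; case: cid2.
have k_small i : (i <= (N * 3 ^ r).+1)%N -> 2 * Q%:Z * `|k i| <= p%:Z.
  move=> le_i; rewrite leNgt; apply/negP => lt_k; apply: H; exists i => //.
  by rewrite -kE; apply: one_sub_ecos_ge.
pose u i := k i - k i.+1.
have g1 : g != 1 by rewrite -(expr1 g) ord_g // expn_gt0.
apply: (@no_small_geometric_sequence p p_pr g g_neq0 Q r N (xi * b * (g - 1)) u)=> //.
- by rewrite !mulf_neq0 // subr_eq0.
- by move=> j _; rewrite intrB !kE exprS; ring.
- move=> j le_j; have := k_small j (leqW le_j); have := k_small j.+1 le_j.
  by rewrite /u; move: (k _) (k _) => x y; nia.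
- move=> j le_j; apply: (@le_lt_trans _ _ (p%:Z * 2 ^+ N)); last first.
    by rewrite -!natz -!natrX -natrM ltr_nat.
  apply: ler_wpM2r; first by rewrite exprn_ge0.
  by have := k_le j; have := k_le j.+1; rewrite /u; lia.
Qed.

(** Conjugating the homothety g^i by x |-> a + b x and undoing it by g^(-i)
    leaves the translation by a (1 - g^i).  Summing the resulting energies over
    i, each nonzero frequency is detected by at least one translation. *)
Lemma variance_le_homothety_energy (F : 'F_p -> R) (a b : 'F_p) :
  a != 0 -> b != 0 ->
  p%:R * \sum_x F x ^+ 2 - (\sum_x F x) ^+ 2
  <= p%:R * (Q%:R ^+ 2 * (N * 3 ^ r + 2)%:R ^+ 3
      * (\sum_x (F (g * x) - F x) ^+ 2
         + \sum_x (F (a + b * (g * x)) - F (a + b * x)) ^+ 2)).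
Proof.
move=> a0 b0; set E0 := \sum_x (F (g * x) - _) ^+ 2.
set E1 := \sum_x (F (a + b * (g * x)) - _) ^+ 2.
have E0_ge0 : 0 <= E0 by apply: sumr_ge0 => x _; rewrite sqr_ge0.
have E1_ge0 : 0 <= E1 by apply: sumr_ge0 => x _; rewrite sqr_ge0.
have p_gt2 : (2 < p)%N by exact: ltnW.
pose tau i := a * (1 - g ^+ i).
pose T i := \sum_x (F (x + tau i) - F x) ^+ 2.
have iterg i x : iter i ( *%R g) x = g ^+ i * x.
  by elim: i => [|i IHi]; rewrite ?mul1r //= IHi exprS mulrA.
have T_le i : T i <= 2 * i%:R ^+ 2 * (E0 + E1).
  have h0 := sum_sqr_iter_le F i (mulfI g_neq0).
  have h1 := sum_sqr_iter_le (fun x => F (a + b * x)) i (mulfI g_neq0).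
  have phi_inj : injective (fun x => a + b * x).
    by move=> x y /addrI /(mulfI b0).
  (* at z = g^i (a + b x), the point z + tau_i is a + b g^i x *)
  have TE : T i = \sum_x (F (a + b * (g ^+ i * x)) - F (g ^+ i * (a + b * x))) ^+ 2.
    rewrite /T (reindex_inj (mulfI (expf_neq0 i g_neq0))) /=.
    rewrite (reindex_inj phi_inj) /=; apply: eq_bigr => x _.
    by congr ((F _ - _) ^+ 2); rewrite /tau; ring.
  have h2 : \sum_x (F (g ^+ i * (a + b * x)) - F (a + b * x)) ^+ 2
      <= i%:R ^+ 2 * E0.
    apply: le_trans h0; rewrite [X in _ <= X](reindex_inj phi_inj) /=.
    by apply: ler_sum => x _; rewrite iterg.
  have h3 : \sum_x (F (a + b * (g ^+ i * x)) - F (a + b * x)) ^+ 2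
      <= i%:R ^+ 2 * E1.
    by apply: le_trans h1; apply: ler_sum => x _; rewrite iterg.
  have : T i <= 2 * (\sum_x (F (a + b * (g ^+ i * x)) - F (a + b * x)) ^+ 2)
             + 2 * (\sum_x (F (g ^+ i * (a + b * x)) - F (a + b * x)) ^+ 2).
    rewrite TE !mulr_sumr -big_split /=; apply: ler_sum => x _.
    move: (F (a + b * (g ^+ i * x))) (F (g ^+ i * _)) (F (a + b * x)) => u v w.
    have := sqr_ge0 (u - 2 * w + v); lra.
  by lra.
have sum_T : \sum_(i < (N * 3 ^ r).+2) T i
    <= 2 * (N * 3 ^ r + 2)%:R ^+ 3 * (E0 + E1).
  have -> : 2 * (N * 3 ^ r + 2)%:R ^+ 3 * (E0 + E1)
    = \sum_(i < (N * 3 ^ r).+2) (2 * (N * 3 ^ r + 2)%:R ^+ 2 * (E0 + E1)).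
    by rewrite sumr_const card_ord addn2 -mulr_natr; ring.
  apply: ler_sum => i _; apply: le_trans (T_le i) _.
  apply: ler_wpM2r; first exact: addr_ge0.
  by rewrite ler_pM2l // -!natrX ler_nat leq_exp2r // addn2 ltnW.
have spectral i : p%:R * T i
    = \sum_xi 2 * (1 - ecos R (xi * tau i)) * fourier_mass F xi.
  rewrite /T -parseval //; apply: eq_bigr => xi _.
  by rewrite fourier_mass_difference.
rewrite -parseval // -fourier_mass0 (bigD1 0) //= [leLHS]addrAC subrr add0r.
have W_le xi : xi != 0 -> fourier_mass F xi
    <= Q%:R ^+ 2 / 2
       * \sum_(i < (N * 3 ^ r).+2) (2 * (1 - ecos R (xi * tau i)) * fourier_mass F xi).
  move=> xi0; have [i le_i far] := some_frequency_far a0 xi0.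
  have term_ge0 (j : 'I_(N * 3 ^ r).+2) :
      0 <= 2 * (1 - ecos R (xi * tau j)) * fourier_mass F xi.
    by rewrite mulr_ge0 ?fourier_mass_ge0 // mulr_ge0 // subr_ge0 ecos_le1.
  rewrite (bigD1 (Ordinal (le_i : (i < (N * 3 ^ r).+2)%N))) //=.
  have rest_ge0 := sumr_ge0 _
    (fun j (_ : j != Ordinal (le_i : (i < (N * 3 ^ r).+2)%N)) => term_ge0 j).
  rewrite mulrDr -[leLHS]addr0; apply: lerD; last first.
    by rewrite mulr_ge0 // divr_ge0 // sqr_ge0.
  have -> : Q%:R ^+ 2 / 2 * (2 * (1 - ecos R (xi * tau i)) * fourier_mass F xi)
    = Q%:R ^+ 2 * (1 - ecos R (xi * tau i)) * fourier_mass F xi by field.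
  by rewrite -[leLHS]mul1r; apply: ler_wpM2r; [exact: fourier_mass_ge0 | exact: far].
apply: le_trans (ler_sum _ W_le) _; rewrite -mulr_sumr.
apply: (@le_trans _ _ (Q%:R ^+ 2 / 2 * (p%:R * \sum_(i < (N * 3 ^ r).+2) T i))).
  apply: ler_wpM2l; first by rewrite divr_ge0 // sqr_ge0.
  rewrite mulr_sumr exchange_big /=; apply: ler_sum => i _.
  rewrite spectral [leRHS](bigD1 0) //= lerDr.
  by rewrite mulr_ge0 ?fourier_mass_ge0 // mulr_ge0 // subr_ge0 ecos_le1.
rewrite mulrCA; apply: ler_wpM2l => //.
apply: (@le_trans _ _ (Q%:R ^+ 2 / 2 * (2 * (N * 3 ^ r + 2)%:R ^+ 3 * (E0 + E1)))).
  by apply: ler_wpM2l => //; rewrite divr_ge0 // sqr_ge0.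
rewrite le_eqVlt; apply/orP; left; by apply/eqP; field.
Qed.
End SpectralGap.

(** * The transition operators and their loss of norm *)

Section Operators.
Variables (R : realType) (F : finFieldType) (alpha beta gamma : F).
Hypotheses (alpha0 : alpha != 0) (beta0 : beta != 0) (gamma0 : gamma != 0).
Local Notation f_ := (fstar alpha beta).

Lemma fstar_denom_neq0 x : x != - beta / alpha -> alpha * x + beta != 0.
Proof.
apply: contra; rewrite addr_eq0 => /eqP eq_x.
by apply/eqP; rewrite -eq_x mulrC mulKf.
Qed.

Lemma fstar0 : f_ 0 = 0.
Proof.
by rewrite /fstar eq_sym mulf_eq0 oppr_eq0 invr_eq0 (negPf alpha0) (negPf beta0)
  mul0r.
Qed.

Lemma fstar_inj : injective f_.
Proof.
have exc x : x != - beta / alpha -> alpha^-1 != x / (alpha * x + beta).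
  move=> /fstar_denom_neq0 d0; apply: contraNneq beta0 => eq_x.
  have : x = alpha^-1 * (alpha * x + beta) by rewrite eq_x mulfVK.
  rewrite mulrDr mulKf // -{1}[x]addr0 => /addrI/esym/eqP.
  by rewrite mulf_eq0 invr_eq0 (negPf alpha0).
move=> x y; rewrite /fstar.
case: eqVneq => [->|nx]; case: eqVneq => [-> //|ny].
- by move/eqP; rewrite (negPf (exc _ ny)).
- by move/esym/eqP; rewrite (negPf (exc _ nx)).
move/eqP; rewrite eqr_div ?fstar_denom_neq0 // => /eqP eq_xy.
apply: (mulIf beta0); move: eq_xy.
by rewrite !mulrDr !(mulrCA _ alpha) (mulrC y x) => /addrI.
Qed.

Lemma fstar_eq0 x : (f_ x == 0) = (x == 0).
Proof. by rewrite -{1}fstar0 (inj_eq fstar_inj). Qed.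

Lemma sum_fstar (G : F -> R) : \sum_(x | x != 0) G (f_ x) = \sum_(x | x != 0) G x.
Proof.
rewrite [RHS](reindex_inj fstar_inj) /=.
by apply: eq_bigl => x; rewrite fstar_eq0.
Qed.

Lemma sum_mulr (u : F) (G : F -> R) : u != 0 ->
  \sum_(x | x != 0) G (x * u) = \sum_(x | x != 0) G x.
Proof.
move=> u0; rewrite [RHS](reindex_inj (mulIf u0)) /=.
by apply: eq_bigl => x; rewrite mulf_eq0 (negPf u0) orbF.
Qed.

Definition normsq (h : F -> R) : R := \sum_(x | x != 0) h x ^+ 2.
Definition dilation_energy (h : F -> R) : R :=
  \sum_(x | x != 0) (h (x * gamma ^+ 2) - h x) ^+ 2.

Definition lazy_op (h : F -> R) (x : F) : R :=
  h x / 2 + (h (f_ x * gamma^-1) + h (f_ x * gamma)) / 4.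
Definition three_op (h : F -> R) (x : F) : R :=
  (h (f_ x) + h (f_ x * gamma^-1) + h (f_ x * gamma)) / 3.

Lemma sum_lazy_op h : \sum_(x | x != 0) lazy_op h x = \sum_(x | x != 0) h x.
Proof.
rewrite big_split /= -!mulr_suml big_split /=.
rewrite (sum_fstar (fun y => h (y * gamma^-1))) (sum_fstar (fun y => h (y * gamma))).
by rewrite !sum_mulr ?invr_eq0 //; field.
Qed.

Lemma sum_three_op h : \sum_(x | x != 0) three_op h x = \sum_(x | x != 0) h x.
Proof.
rewrite -mulr_suml !big_split /= (sum_fstar h).
rewrite (sum_fstar (fun y => h (y * gamma^-1))) (sum_fstar (fun y => h (y * gamma))).
by rewrite !sum_mulr ?invr_eq0 //; field.
Qed.

Lemma normsq_ge0 h : 0 <= normsq h.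
Proof. by apply: sumr_ge0 => x _; rewrite sqr_ge0. Qed.

Lemma dilation_energyE h :
  dilation_energy h
  = \sum_(x | x != 0) (h (f_ x * gamma^-1) - h (f_ x * gamma)) ^+ 2.
Proof.
rewrite (sum_fstar (fun y => (h (y * gamma^-1) - h (y * gamma)) ^+ 2)).
rewrite -[RHS](sum_mulr _ gamma0); apply: eq_bigr => x _.
by rewrite mulfK // -mulrA -expr2 -[RHS]sqrrN opprB.
Qed.

(** The loss of norm is the variance of h over the three possible next states,
    with weights 1/2, 1/4, 1/4. *)
Lemma normsq_lazy_op h :
  normsq (lazy_op h) = normsq h
    - (8^-1 * \sum_(x | x != 0) (h x - h (f_ x * gamma^-1)) ^+ 2
       + 8^-1 * \sum_(x | x != 0) (h x - h (f_ x * gamma)) ^+ 2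
       + 16^-1 * dilation_energy h).
Proof.
have -> : normsq h = \sum_(x | x != 0)
    (h x ^+ 2 / 2 + (h (f_ x * gamma^-1) ^+ 2 + h (f_ x * gamma) ^+ 2) / 4).
  exact/esym/(sum_lazy_op (fun x => h x ^+ 2)).
rewrite dilation_energyE !mulr_sumr -!big_split -sumrB /=.
by apply: eq_bigr => x _; rewrite /lazy_op; field.
Qed.

(** The loss of norm is the variance of h over the three equiprobable next
    states. *)
Lemma normsq_three_op h :
  normsq (three_op h) = normsq h
    - 9^-1 * (\sum_(x | x != 0) (h (f_ x) - h (f_ x * gamma^-1)) ^+ 2
       + \sum_(x | x != 0) (h (f_ x) - h (f_ x * gamma)) ^+ 2
       + dilation_energy h).
Proof.
have -> : normsq h = \sum_(x | x != 0)
    ((h (f_ x) ^+ 2 + h (f_ x * gamma^-1) ^+ 2 + h (f_ x * gamma) ^+ 2) / 3).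
  exact/esym/(sum_three_op (fun x => h x ^+ 2)).
rewrite dilation_energyE -!big_split mulr_sumr -sumrB /=.
by apply: eq_bigr => x _; rewrite /three_op; field.
Qed.

Lemma normsq_three_op_le h : normsq (three_op h) <= normsq h.
Proof.
rewrite normsq_three_op gerBl mulr_ge0 // !addr_ge0 //;
by apply: sumr_ge0 => x _; rewrite sqr_ge0.
Qed.

Lemma normsq_lazy_op_le h : normsq (lazy_op h) <= normsq h.
Proof.
rewrite normsq_lazy_op gerBl !addr_ge0 // mulr_ge0 //;
by apply: sumr_ge0 => x _; rewrite sqr_ge0.
Qed.

Let gamma20 : gamma ^+ 2 != 0. Proof. exact: expf_neq0. Qed.

Lemma dilation_energy_approx (h k : F -> R) :
  dilation_energy h <= 3 * dilation_energy k
    + 6 * \sum_(x | x != 0) (k x - h x) ^+ 2.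
Proof.
set S := \sum_(x | _) (k x - h x) ^+ 2.
have -> : 3 * dilation_energy k + 6 * S = 3 * (dilation_energy k
   + (\sum_(x | x != 0) (k (x * gamma ^+ 2) - h (x * gamma ^+ 2)) ^+ 2 + S)).
  by rewrite (sum_mulr (fun x => (k x - h x) ^+ 2) gamma20) -/S; ring.
rewrite -!big_split mulr_sumr /=; apply: ler_sum => x _.
move: (h (x * _)) (h x) (k (x * _)) (k x) => a b c d.
have := sqr_ge0 ((c - d) - (d - b)); have := sqr_ge0 ((c - d) + (c - a)).
have := sqr_ge0 ((c - a) + (d - b)); lra.
Qed.

Variable K : R.
Hypothesis K_ge0 : 0 <= K.
Hypothesis poincare : forall h, \sum_(x | x != 0) h x = 0 ->
  normsq h <= K * (dilation_energy h + dilation_energy (h \o f_)).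

(** If the norm hardly drops, then h x is close to both h (f_* x * gamma) and
    h (f_* x / gamma).  Thus the translate k x = h (x * gamma) is almost invariant
    under gamma^2, and so is k \o f_*, which is close to h. *)
Lemma lazy_op_contraction h : \sum_(x | x != 0) h x = 0 ->
  normsq h <= 112 * K * (normsq h - normsq (lazy_op h)).
Proof.
move=> h0; pose k x := h (x * gamma).
have k0 : \sum_(x | x != 0) k x = 0 by rewrite /k (sum_mulr h gamma0).
have normk : normsq k = normsq h.
  exact: (sum_mulr (fun x => h x ^+ 2) gamma0).
have Dk : dilation_energy k = dilation_energy h.
  rewrite /dilation_energy -[RHS](sum_mulr _ gamma0); apply: eq_bigr => x _.
  by rewrite /k -!mulrA [gamma * _]mulrC.
have := poincare k0; rewrite normk Dk => h1.
have h2 := dilation_energy_approx (k \o f_) h.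
rewrite -mulrA mulrCA; apply: le_trans h1 _; apply: ler_wpM2l => //.
rewrite normsq_lazy_op.
have : 0 <= \sum_(x | x != 0) (h x - h (f_ x * gamma^-1)) ^+ 2.
  by apply: sumr_ge0 => x _; rewrite sqr_ge0.
have : 0 <= \sum_(x | x != 0) (h x - h (f_ x * gamma)) ^+ 2.
  by apply: sumr_ge0 => x _; rewrite sqr_ge0.
have : 0 <= dilation_energy h.
  by apply: sumr_ge0 => x _; rewrite sqr_ge0.
rewrite /= /k in h2 *; lra.
Qed.

(** A single step only reveals the near invariance of h under gamma.  The second
    step reveals that of [three_op h], which is then close to h \o f_*. *)
Lemma three_op_contraction h : \sum_(x | x != 0) h x = 0 ->
  normsq h <= 112 * K * (normsq h - normsq (three_op (three_op h))).
Proof.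
move=> h0; have h1 := poincare h0.
have h2 := dilation_energy_approx (h \o f_) (three_op h).
set S1 := \sum_(x | x != 0) (h (f_ x) - h (f_ x * gamma^-1)) ^+ 2.
set S2 := \sum_(x | x != 0) (h (f_ x) - h (f_ x * gamma)) ^+ 2.
have h3 : \sum_(x | x != 0) (three_op h x - (h \o f_) x) ^+ 2
    <= 2 / 9 * (S1 + S2).
  rewrite -big_split mulr_sumr; apply: ler_sum => x _ /=.
  rewrite /three_op; move: (h (f_ x)) (h (_ * gamma^-1)) (h (_ * gamma)) => a b c.
  have := sqr_ge0 (b - c); nra.
have S1_ge0 : 0 <= S1 by apply: sumr_ge0 => x _; rewrite sqr_ge0.
have S2_ge0 : 0 <= S2 by apply: sumr_ge0 => x _; rewrite sqr_ge0.
have D_ge0 k : 0 <= dilation_energy k.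
  by apply: sumr_ge0 => x _; rewrite sqr_ge0.
have e1 := normsq_three_op h; rewrite -/S1 -/S2 in e1.
have e2 : normsq (three_op (three_op h))
    <= normsq (three_op h) - 9^-1 * dilation_energy (three_op h).
  rewrite normsq_three_op lerD2l lerN2 ler_wpM2l // lerDr addr_ge0 //;
  by apply: sumr_ge0 => x _; rewrite sqr_ge0.
rewrite -mulrA mulrCA; apply: le_trans h1 _; apply: ler_wpM2l => //.
have := D_ge0 h; have := D_ge0 (three_op h); lra.
Qed.

End Operators.

(** * Poincare inequality and decay for the map f_* *)

(** The number N * 3^r + 1 bounds the exponents of g that are needed to detect
    every frequency. *)
Definition poincare_const (R : realType) (Q r N : nat) : R :=
  Q%:R ^+ 2 * (N * 3 ^ r + 2)%:R ^+ 3.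

(** In the coordinate y = 1/x the function h extends to F_p by the value
    h (1/alpha) at 0.  This value makes f_* correspond to the affine map
    everywhere: f_* sends the pole -beta/alpha to 1/alpha, the point reached by
    applying the affine map once more at y = 0.  The terms of both
    energies at y = 0 vanish, so the extension costs nothing. *)
Lemma normsq_le_dilation_energy (R : realType) (p Q r N : nat)
    (alpha beta gamma : 'F_p) (h : 'F_p -> R) :
  prime p -> (3 < p)%N -> (r`! * p < Q ^ r)%N -> (p * 2 ^ N < 3 ^ N)%N ->
  (forall d, (0 < d)%N -> (d <= 3 ^ r)%N -> (gamma ^+ 2) ^+ d != 1) ->
  alpha != 0 -> beta != 0 -> gamma != 0 ->
  \sum_(x | x != 0) h x = 0 ->
  normsq h <= poincare_const R Q r N
    * (dilation_energy gamma h
       + dilation_energy gamma (h \o fstar alpha beta)).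
Proof.
move=> p_pr p_gt3 ltQ ltN ord_g alpha0 beta0 gamma0 h0.
pose g := gamma ^- 2.
have g0 : g != 0 by rewrite invr_eq0 expf_neq0.
have ord_gV d : (0 < d)%N -> (d <= 3 ^ r)%N -> g ^+ d != 1.
  by move=> d0 dr; rewrite exprVn invr_eq1 ord_g.
pose F y := if y == 0 then h alpha^-1 else h y^-1.
have F0 : F 0 = h alpha^-1 by rewrite /F eqxx.
have Fn y : y != 0 -> F y = h y^-1 by rewrite /F => /negPf ->.
have Fphi y : y != 0 -> F (alpha + beta * y) = h (fstar alpha beta y^-1).
  move=> y0; rewrite /F /fstar.
  have -> : (y^-1 == - beta / alpha) = (alpha + beta * y == 0).
    rewrite -(inj_eq (mulIf y0)) mulVf // -(inj_eq (mulfI alpha0)) mulr1.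
    by rewrite mulNr mulNr mulrN mulrA mulrA (mulrC alpha) mulfK // addr_eq0.
  case: eqVneq => [//|d0]; congr h.
  have -> : alpha * y^-1 + beta = (alpha + beta * y) / y.
    by rewrite mulrDl mulfK.
  by rewrite invfM invrK mulrCA mulVf // mulr1.
have sumV (G : 'F_p -> R) : \sum_(y | y != 0) G y^-1 = \sum_(x | x != 0) G x.
  rewrite [RHS](reindex_inj invr_inj) /=.
  by apply: eq_bigl => x; rewrite invr_eq0.
have E0 : \sum_y (F (g * y) - F y) ^+ 2 = dilation_energy gamma h.
  rewrite (bigD1 0) //= mulr0 subrr expr0n add0r.
  rewrite -[RHS](sumV (fun x => (h (x * gamma ^+ 2) - h x) ^+ 2)).
  apply: eq_bigr => y y0; rewrite !Fn ?mulf_neq0 //.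
  by rewrite invfM invrK mulrC.
have E1 : \sum_y (F (alpha + beta * (g * y)) - F (alpha + beta * y)) ^+ 2
    = dilation_energy gamma (h \o fstar alpha beta).
  rewrite (bigD1 0) //= mulr0 subrr expr0n add0r.
  rewrite -[RHS](sumV (fun x => (h (fstar alpha beta (x * gamma ^+ 2))
     - h (fstar alpha beta x)) ^+ 2)).
  apply: eq_bigr => y y0; rewrite !Fphi ?mulf_neq0 //.
  by rewrite invfM invrK (mulrC (gamma ^+ 2)).
have := variance_le_homothety_energy p_pr p_gt3 ltQ ltN g0 ord_gV F alpha0 beta0.
rewrite E0 E1 (bigD1 0) //= [\sum_x F x](bigD1 0) //= F0.
have -> : \sum_(y | y != 0) F y = 0.
  by rewrite -[RHS]h0 -[RHS](sumV h); apply: eq_bigr => y /Fn.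
have -> : \sum_(y | y != 0) F y ^+ 2 = normsq h.
  rewrite /normsq -(sumV (fun x => h x ^+ 2)).
  by apply: eq_bigr => y /Fn ->.
rewrite addr0 => le_var.
have p_ge1 : 1 <= p%:R :> R by rewrite ler1n prime_gt0.
rewrite -(ler_pM2l (lt_le_trans ltr01 p_ge1)); apply: le_trans le_var.
have := sqr_ge0 (h alpha^-1); have := normsq_ge0 h; nra.
Qed.

(** Two steps are counted together because the contraction of the three-valued
    chain needs two of them. *)
Lemma normsq_iter_le (R : realType) (F : finFieldType) (theta : R)
    (op : (F -> R) -> F -> R) (h : F -> R) (n : nat) :
  0 <= theta ->
  (forall k, \sum_(x | x != 0) op k x = \sum_(x | x != 0) k x) ->
  (forall k, normsq (op k) <= normsq k) ->
  (forall k, \sum_(x | x != 0) k x = 0 ->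
     normsq (op (op k)) <= theta * normsq k) ->
  \sum_(x | x != 0) h x = 0 ->
  normsq (iter n op h) <= theta ^+ n./2 * normsq h.
Proof.
move=> theta0 sum_op le_op contr h0.
have even m : normsq (iter m.*2 op h) <= theta ^+ m * normsq h.
  elim: m => [|m IHm]; first by rewrite mul1r.
  rewrite doubleS /=; apply: le_trans (contr _ _) _.
    by elim: (m.*2) => //= j IHj; rewrite sum_op.
  by rewrite exprS -mulrA ler_wpM2l.
rewrite -{1}(odd_double_half n); case: (odd n) => /=; last exact: even.
by apply: le_trans (le_op _) _; exact: even.
Qed.

(** * Finite-valued random variables and independence *)

Section FiniteValued.
Local Open Scope classical_set_scope.
Context (R : realType) (d : measure_display) (T : measurableType d).
Variable P : probability T R.

Definition pr (A : set T) : R := fine (P A).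

Lemma prE A : measurable A -> P A = (pr A)%:E.
Proof. by move=> mA; rewrite /pr fineK // fin_num_measure. Qed.

Lemma pr_ge0 A : 0 <= pr A.
Proof. exact: fine_ge0. Qed.

Lemma prU (A B : set T) : measurable A -> measurable B -> A `&` B = set0 ->
  pr (A `|` B) = pr A + pr B.
Proof.
by move=> mA mB AB0; rewrite /pr measureU // fineD // fin_num_measure.
Qed.

Lemma discrete_rv_measurable (V : finType) (Y : T -> V) (D : set V) :
  discrete_rv Y -> measurable (Y @^-1` D).
Proof.
move=> mY; have -> : Y @^-1` D = \bigcup_(v in D) (Y @^-1` [set v]).
  by apply/seteqP; split=> [w Dw|w [v Dv /= ->] //]; exists (Y w).
by apply: fin_bigcup_measurable => [|v _]; [exact: finite_finset | exact: mY].
Qed.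

Lemma discrete_rv_pair (V W : finType) (Y : T -> V) (Y' : T -> W) :
  discrete_rv Y -> discrete_rv Y' -> discrete_rv (fun w => (Y w, Y' w)).
Proof.
move=> mY mY' [v v']; rewrite (_ : _ @^-1` _ = Y @^-1` [set v] `&` Y' @^-1` [set v']).
  by apply: measurableI; [exact: mY | exact: mY'].
by apply/seteqP; split=> w /=; [case=> -> -> | case=> <- <-].
Qed.

Lemma pr_fibers (V : finType) (Y : T -> V) (B : set T) (D : pred V) :
  discrete_rv Y -> measurable B ->
  pr (B `&` Y @^-1` [set v | D v]) = \sum_(v | D v) pr (B `&` Y @^-1` [set v]).
Proof.
move=> mY mB; rewrite -big_filter.
have -> : [set v | D v] = [set` [seq v <- index_enum V | D v]].
  by apply/seteqP; split=> v /=; rewrite mem_filter mem_index_enum andbT.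
have: uniq [seq v <- index_enum V | D v] by rewrite filter_uniq ?index_enum_uniq.
move: [seq v <- _ | _] => s; elim: s => [_|v s IHs /= /andP[vs us]].
  rewrite big_nil (_ : B `&` _ = set0) ?/pr ?measure0 //.
  by apply/seteqP; split=> w //= [].
rewrite big_cons -IHs // -prU.
- congr pr; apply/seteqP; split=> w /=.
    by rewrite inE => -[Bw /orP[/eqP|]]; [left|right].
  by rewrite inE => -[] [Bw e]; split=> //; rewrite e ?eqxx ?orbT.
- by apply: measurableI => //; exact: mY.
- by apply: measurableI => //; exact: discrete_rv_measurable.
- apply/seteqP; split=> w //= -[[_ ->] [_]]; by rewrite (negPf vs).
Qed.

Lemma pr_le1 A : measurable A -> pr A <= 1.
Proof. by move=> mA; rewrite -lee_fin -prE // probability_le1. Qed.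

(** The definition of independence quantifies over a family of events indexed by
    I; the list l prescribes the events at finitely many indices. *)
Lemma pr_independent (I : choiceType) (F : I -> set (set T))
    (l : seq (I * set T)) :
  mutually_independent P F -> uniq (map fst l) ->
  (forall e, e \in l -> F e.1 e.2) ->
  (forall e, e \in l -> measurable e.2) ->
  pr (\big[setI/setT]_(e <- l) e.2) = \prod_(e <- l) pr e.2.
Proof.
move=> indep ul Fl ml.
pose E i := nth setT (map snd l) (index i (map fst l)).
have EE e : e \in l -> E e.1 = e.2.
  move=> el; rewrite /E.
  have lt_i : (index e l < size l)%N by rewrite index_mem.
  have -> : index e.1 (map fst l) = index e l.
    rewrite -{1}(nth_index e el) -(nth_map e e.1 fst) // index_uniq //.
    by rewrite size_map.
  by rewrite (nth_map e) // nth_index.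
have := indep (map fst l) E ul.
rewrite bigcap_seq !big_map.
have -> : \big[setI/setT]_(e <- l) E e.1 = \big[setI/setT]_(e <- l) e.2.
  by apply: eq_big_seq => e /EE.
have -> : (\prod_(e <- l) P (E e.1))%E = (\prod_(e <- l) pr e.2)%:E.
  rewrite -prodEFin; apply: eq_big_seq => e el /=.
  by rewrite EE // prE //; exact: ml.
move=> H; rewrite /pr H // => i /mapP[e el ->]; rewrite EE //; exact: Fl.
Qed.

End FiniteValued.

(** * Chains driven by independent noise *)

Section DrivenChain.
Local Open Scope classical_set_scope.
Context (R : realType) (d : measure_display) (T : measurableType d).
Variable P : probability T R.
Variables (W V : finType) (step : W -> V -> W) (nu : V -> R).
Variables (X : nat -> T -> W) (Z : nat -> T -> V).

Fixpoint noise_event (n : nat) (s : seq V) : set T :=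
  if s is v :: s' then (Z n @^-1` [set v]) `&` noise_event n.+1 s' else setT.

Hypothesis mX0 : discrete_rv (X 0).
Hypothesis mZ : forall j, discrete_rv (Z j).
Hypothesis Xstep : forall j w, X j.+1 w = step (X j w) (Z j w).
Hypothesis product_law : forall x s,
  pr P (X 0 @^-1` [set x] `&` noise_event 0 s)
  = pr P (X 0 @^-1` [set x]) * \prod_(v <- s) nu v.

Lemma measurable_noise_event n s : measurable (noise_event n s).
Proof.
elim: s n => [|v s IHs] n; first exact: measurableT.
by apply: measurableI; [exact: mZ | exact: IHs].
Qed.

Let XZ n w := (X n w, Z n w).

Let preimage_step n y : X n.+1 @^-1` [set y]
  = XZ n @^-1` [set xv | step xv.1 xv.2 == y].
Proof.
by apply/seteqP; split=> w /=; rewrite Xstep => /eqP.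
Qed.

Lemma discrete_chain n : discrete_rv (X n).
Proof.
elim: n => [|n IHn] y; first exact: mX0.
rewrite preimage_step; apply: discrete_rv_measurable.
exact: discrete_rv_pair.
Qed.

(** X_{n+1} is a function of X_n and Z_n, so its fibers split into events
    {X_n = x, Z_n = v}, to which the induction hypothesis applies with v put in
    front of the future noise. *)
Lemma chain_future_independent n x s :
  pr P (X n @^-1` [set x] `&` noise_event n s)
  = pr P (X n @^-1` [set x]) * \prod_(v <- s) nu v.
Proof.
elim: n x s => [|n IHn] y s; first exact: product_law.
have split_step s' : pr P (X n.+1 @^-1` [set y] `&` noise_event n.+1 s')
    = (\sum_(xv | step xv.1 xv.2 == y) pr P (X n @^-1` [set xv.1]) * nu xv.2)
      * \prod_(v <- s') nu v.
  rewrite setIC preimage_step pr_fibers; last exact: measurable_noise_event.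
    rewrite mulr_suml; apply: eq_bigr => -[x v] _ /=.
    rewrite -mulrA -[nu v * _](big_cons _ _ _ _ xpredT) -IHn /=; congr (pr P _).
    by apply/seteqP; split=> w /=; [case=> ? [<- <-] | case=> <- [<-]].
  by apply: discrete_rv_pair; [exact: discrete_chain | exact: mZ].
by rewrite split_step -[X n.+1 @^-1` _]setIT -[setT]/(noise_event n.+1 [::])
  split_step big_nil mulr1.
Qed.

Definition transition (h : W -> R) (x : W) : R := \sum_v nu v * h (step x v).

Lemma expectation_step n (h : W -> R) :
  \sum_y pr P (X n.+1 @^-1` [set y]) * h y
  = \sum_x pr P (X n @^-1` [set x]) * transition h x.
Proof.
have joint x v : pr P (XZ n @^-1` [set (x, v)])
    = pr P (X n @^-1` [set x]) * nu v.
  have := chain_future_independent n x [:: v].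
  rewrite big_seq1 => <-; congr (pr P _).
  by apply/seteqP; split=> w /=; [case=> <- <- | case=> <- [<-]].
under eq_bigr => y _.
  rewrite preimage_step -[_ @^-1` _]setTI pr_fibers; last exact: measurableT.
    rewrite mulr_suml; over.
  by apply: discrete_rv_pair; [exact: discrete_chain | exact: mZ].
rewrite /= (exchange_big_dep xpredT) //=.
under [RHS]eq_bigr => x _ do rewrite /transition mulr_sumr.
rewrite pair_big /=; apply: eq_bigr => -[x v] _ /=.
rewrite (eq_bigl (pred1 (step x v))); last by move=> y; rewrite /= eq_sym.
by rewrite big_pred1_eq setTI joint mulrA.
Qed.

Lemma expectation_iter n (h : W -> R) :
  \sum_y pr P (X n @^-1` [set y]) * h y
  = \sum_x pr P (X 0 @^-1` [set x]) * iter n transition h x.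
Proof.
elim: n h => // n IHn h; by rewrite expectation_step IHn iterSr.
Qed.

Lemma sum_law n : \sum_y pr P (X n @^-1` [set y]) = 1.
Proof.
have <- : pr P setT = 1 by rewrite /pr probability_setT.
have -> : [set: T] = setT `&` X n @^-1` [set x | xpredT x].
  by rewrite setTI; apply/seteqP; split.
rewrite pr_fibers; [|exact: discrete_chain|exact: measurableT].
by apply: eq_bigr => y _; rewrite setTI.
Qed.

End DrivenChain.

(** * From the L^2 decay to total variation *)

(** The difference of the two sides is a variance. *)
Lemma sqr_mean_le (R : realFieldType) (W : finType) (mu k : W -> R) :
  (forall x, 0 <= mu x) -> \sum_x mu x = 1 ->
  (\sum_x mu x * k x) ^+ 2 <= \sum_x mu x * k x ^+ 2.
Proof.
move=> mu_ge0 mu1; set m := \sum_x mu x * k x.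
rewrite -subr_ge0 (_ : _ - _ = \sum_x mu x * (k x - m) ^+ 2).
  by apply: sumr_ge0 => x _; rewrite mulr_ge0 ?sqr_ge0.
have -> : \sum_x mu x * (k x - m) ^+ 2 = \sum_x
    (mu x * k x ^+ 2 - 2 * m * (mu x * k x) + m ^+ 2 * mu x).
  by apply: eq_bigr => x _; ring.
rewrite big_split sumrB -!mulr_sumr mu1 -/m /=; ring.
Qed.

Section TotalVariation.
Local Open Scope classical_set_scope.
Context (R : realType) (d : measure_display) (T : measurableType d).
Variable P : probability T R.

(** For a set A of nonzero elements, the deviation of P (X_n in A) from the
    uniform weight is the expectation of the centered indicator of A, and it is
    carried back to time 0 by the transition operator.  There the law of X_0 is
    dominated by the counting measure on the nonzero elements. *)
Lemma tv_unif_le (p : nat) (V : finType) (step : 'F_p -> V -> 'F_p)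
    (nu : V -> R) (X : nat -> T -> 'F_p) (Z : nat -> T -> V)
    (theta B : R) (n : nat) :
  prime p ->
  discrete_rv (X 0) -> (forall j, discrete_rv (Z j)) ->
  (forall j w, X j.+1 w = step (X j w) (Z j w)) ->
  (forall x s, pr P (X 0 @^-1` [set x] `&` noise_event Z 0 s)
     = pr P (X 0 @^-1` [set x]) * \prod_(v <- s) nu v) ->
  (forall w, X 0 w != 0) ->
  (forall h : 'F_p -> R, \sum_(x | x != 0) h x = 0 ->
     normsq (iter n (transition step nu) h) <= theta * normsq h) ->
  0 <= theta -> 0 <= B -> theta * p%:R <= B ^+ 2 ->
  tv_unif P (X n) <= B.
Proof.
move=> p_pr mX0 mZ Xstep law X0_neq0 decay theta0 B0 leB.
have p_gt1 := prime_gt1 p_pr.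
have q0 : 0 < p.-1%:R :> R by rewrite ltr0n -ltnS prednK // ltnW.
suff dev (A : {set 'F_p}) : A \subset [set~ 0]%SET ->
    `| fine (P (X n @^-1` [set` A])) - #|A|%:R / p.-1%:R | <= B.
  rewrite /tv_unif; apply: (@le_trans _ _ (2^-1 * B)); last by lra.
  by rewrite ler_pM2l //; apply: bigmax_le => // A; exact: dev.
move=> subA; pose h x : R := (x \in A)%:R - #|A|%:R / p.-1%:R.
have A0 : 0 \notin A.
  apply: contraTN subA => A0; apply/subsetPn; exists 0 => //.
  by rewrite !inE eqxx.
have card_nz : #|[pred x : 'F_p | x != 0]| = p.-1.
  have <- : #|predC1 (0 : 'F_p)| = p.-1 by rewrite cardC1 card_Fp.
  exact: eq_card.
have sum_in : \sum_x ((x \in A)%:R : R) = #|A|%:R.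
  rewrite -sum1_card natr_sum [RHS]big_mkcond /=.
  by apply: eq_bigr => x _; case: (_ \in _).
have h_mean : \sum_(x | x != 0) h x = 0.
  rewrite sumrB sumr_const card_nz -[_ *+ p.-1]mulr_natr mulfVK ?gt_eqF //.
  by rewrite -sum_in [\sum_x _](bigD1 0) //= (negPf A0) add0r subrr.
have h_norm : normsq h <= p%:R.
  have -> : p%:R = \sum_(x : 'F_p) 1 :> R by rewrite sumr_const card_Fp.
  rewrite [leRHS](bigD1 0) //= -[leLHS]add0r lerD //; apply: ler_sum => x _.
  have leA : #|A|%:R / p.-1%:R <= 1 :> R.
    rewrite ler_pdivrMr // mul1r ler_nat -card_nz; apply: subset_leq_card.
    apply/fintype.subsetP => y yA.
    by have := fintype.subsetP subA y yA; rewrite !inE.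
  have geA : 0 <= #|A|%:R / p.-1%:R :> R by rewrite divr_ge0 // ltW.
  rewrite /h; move: (#|A|%:R / _) leA geA => c; case: (x \in A) => /=; nra.
pose mu x : R := pr P (X 0%N @^-1` [set x]).
have devE : fine (P (X n @^-1` [set` A])) - #|A|%:R / p.-1%:R
    = \sum_x mu x * iter n (transition step nu) h x.
  rewrite -(expectation_iter mX0 mZ Xstep law) /h.
  under [RHS]eq_bigr do rewrite mulrBr.
  rewrite sumrB -mulr_suml (sum_law P mX0 mZ Xstep n) mul1r; congr (_ - _).
  rewrite -[X n @^-1` _]setTI -[LHS]/(pr P _).
  rewrite (pr_fibers P (mem A)); first last.
  - exact: measurableT.
  - exact: discrete_chain.
  rewrite big_mkcond /=; apply: eq_bigr => y _; rewrite setTI.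
  by case: (y \in A); rewrite ?mulr1 ?mulr0.
rewrite devE -(ler_pXn2r (isT : (0 < 2)%N)) ?nnegrE // real_normK ?num_real //.
apply: le_trans (sqr_mean_le _ _ _) _.
- by move=> x; exact: pr_ge0.
- exact: (sum_law P mX0 mZ Xstep 0).
apply: le_trans leB; apply: le_trans (ler_wpM2l theta0 h_norm).
apply: le_trans (decay h h_mean).
have mu0 : mu 0 = 0.
  rewrite /mu (_ : _ @^-1` _ = set0) ?/pr ?measure0 //.
  by apply/seteqP; split=> w //= X0w; have := X0_neq0 w; rewrite X0w eqxx.
rewrite (bigD1 0) //= mu0 mul0r add0r; apply: ler_sum => x _.
rewrite ler_piMl ?sqr_ge0 //; apply: pr_le1; exact: mX0.
Qed.

End TotalVariation.

(** * The lazy chain and the three-valued chain *)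

Lemma sum_indicator (R : realFieldType) (V : finType) (S : {set V}) (h : V -> R) :
  \sum_v (v \in S)%:R / #|S|%:R * h v = (\sum_(v in S) h v) / #|S|%:R.
Proof.
rewrite mulr_suml [RHS]big_mkcond; apply: eq_bigr => v _.
by case: (v \in S); rewrite ?mul0r // mul1r mulrC.
Qed.

Section Instances.
Local Open Scope classical_set_scope.
Context (R : realType) (d : measure_display) (T : measurableType d).
Variable P : probability T R.
Variables (p : nat) (alpha beta gamma : 'F_p).
Hypothesis p_pr : prime p.

Lemma pr_uniform (V : finType) (S : {set V}) (Y : T -> V) v :
  uniform_on P S Y -> pr P (Y @^-1` [set v]) = (v \in S)%:R / #|S|%:R.
Proof. by move=> uY; rewrite /pr uY. Qed.

Section Lazy.
Variables (X eps : nat -> T -> 'F_p) (coin : nat -> T -> bool).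
Hypothesis chain : lazy_chain P alpha beta gamma X eps coin.

Let S : {set 'F_p} := [set gamma^-1; gamma]%SET.
Let Z j w := (eps j w, coin j w).
Definition lazy_step_fun (x : 'F_p) (v : 'F_p * bool) : 'F_p :=
  if v.2 then fstar alpha beta x * v.1 else x.
Definition lazy_law (v : 'F_p * bool) : R := (v.1 \in S)%:R / #|S|%:R * 2^-1.

(** The noise of one step consists of two independent variables, hence two
    entries with different indices. *)
Fixpoint lazy_events (n : nat) (s : seq ('F_p * bool)) :
    seq (option (nat + nat) * set T) :=
  if s is v :: s' then
    (Some (inl n), eps n @^-1` [set v.1])
    :: (Some (inr n), coin n @^-1` [set v.2]) :: lazy_events n.+1 s'
  else [::].

Lemma lazy_eventsP n s e : e \in lazy_events n s -> exists j, (n <= j)%N /\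
  ((exists B, e = (Some (inl j), eps j @^-1` B))
   \/ (exists B, e = (Some (inr j), coin j @^-1` B))).
Proof.
elim: s n => //= v s IHs n; rewrite !inE => /or3P[/eqP->|/eqP->|/IHs[j [nj H]]].
- by exists n; split=> //; left; exists [set v.1].
- by exists n; split=> //; right; exists [set v.2].
- by exists j; split=> //; exact: ltnW.
Qed.

Lemma lazy_events_uniq n s : uniq (map fst (lazy_events n s)).
Proof.
elim: s n => //= v s IHs n; rewrite inE negb_or IHs andbT /=.
apply/andP; split; apply/mapP => -[e /lazy_eventsP[j [nj]]];
  by case=> -[B ->] //= [ej]; rewrite ej ltnn in nj.
Qed.

Lemma lazy_product_law x s :
  pr P (X 0 @^-1` [set x] `&` noise_event Z 0 s)
  = pr P (X 0 @^-1` [set x]) * \prod_(v <- s) lazy_law v.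
Proof.
pose L := (None, X 0%N @^-1` [set x]) :: lazy_events 0 s.
have LP e : e \in L -> lazy_noise (X 0) eps coin e.1 e.2 /\ measurable e.2.
  rewrite inE => /predU1P[->|/lazy_eventsP[j [_ [[B ->]|[B ->]]]]] /=.
  - by split; [exists [set x] | exact: (lazy_X0_rv chain)].
  - split; first by exists B.
    by apply: discrete_rv_measurable; exact: (lazy_eps_rv chain).
  - split; first by exists B.
    by apply: discrete_rv_measurable; exact: (lazy_coin_rv chain).
have uniq_L : uniq (map fst L).
  rewrite /L /= lazy_events_uniq andbT.
  by apply/mapP=> -[e /lazy_eventsP[j [_ [[B ->]|[B ->]]]]].
have := pr_independent (lazy_indep chain) uniq_L (fun e eL => (LP e eL).1)
  (fun e eL => (LP e eL).2).
rewrite /L !big_cons /= => H.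
have -> : noise_event Z 0 s = \big[setI/setT]_(e <- lazy_events 0 s) e.2.
  elim: s 0%N {L LP uniq_L H} => [|v s IHs] n /=; first by rewrite big_nil.
  rewrite !big_cons -IHs /= setIA; congr (_ `&` _).
  by apply/seteqP; split=> w /=; rewrite /Z; [case: v => a b [-> ->] |
    case: v => a b /= [-> ->]].
rewrite H; congr (_ * _).
elim: s 0%N {L LP uniq_L H} => [|v s IHs] n /=; first by rewrite !big_nil.
rewrite !big_cons -(IHs n.+1) /= mulrA; congr (_ * _); rewrite /lazy_law.
rewrite (pr_uniform _ (lazy_eps_unif chain n)); congr (_ * _).
by rewrite (pr_uniform _ (lazy_coin_unif chain n)) inE cardsT card_bool mul1r.
Qed.

Lemma lazy_transition h : gamma^-1 != gamma ->
  transition lazy_step_fun lazy_law h = lazy_op alpha beta gamma h.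
Proof.
move=> gamma2; apply/funext => x; rewrite /transition.
rewrite -(pair_bigA _ (fun e c => lazy_law (e, c) * h (lazy_step_fun x (e, c)))) /=.
have -> : \sum_e \sum_c lazy_law (e, c) * h (lazy_step_fun x (e, c))
   = \sum_e (e \in S)%:R / #|S|%:R * ((h (fstar alpha beta x * e) + h x) / 2).
  apply: eq_bigr => e _; rewrite big_bool /lazy_law /lazy_step_fun /=.
  by move: (_ / #|S|%:R) => q; field.
rewrite sum_indicator /S big_setU1 ?inE //= big_set1 cards2 gamma2 /=.
by rewrite /lazy_op; field.
Qed.

Lemma lazy_tv_le (theta B : R) (n : nat) : gamma^-1 != gamma ->
  (forall h : 'F_p -> R, \sum_(x | x != 0) h x = 0 ->
     normsq (iter n (lazy_op alpha beta gamma) h) <= theta * normsq h) ->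
  0 <= theta -> 0 <= B -> theta * p%:R <= B ^+ 2 ->
  tv_unif P (X n) <= B.
Proof.
move=> gamma2 decay.
apply: (@tv_unif_le _ _ _ P p _ lazy_step_fun lazy_law X Z) => //.
- exact: (lazy_X0_rv chain).
- move=> j; apply: discrete_rv_pair; first exact: (lazy_eps_rv chain).
  exact: (lazy_coin_rv chain).
- exact: (lazy_step chain).
- exact: lazy_product_law.
- exact: (lazy_X0_neq0 chain).
- rewrite (_ : transition _ _ = lazy_op alpha beta gamma) //.
  by apply/funext => h; exact: lazy_transition.
Qed.

End Lazy.

Section Three.
Variables (X eps : nat -> T -> 'F_p).
Hypothesis chain : three_chain P alpha beta gamma X eps.

Let S : {set 'F_p} := [set 1; gamma^-1; gamma]%SET.
Definition three_step_fun (x v : 'F_p) : 'F_p := fstar alpha beta x * v.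
Definition three_law (v : 'F_p) : R := (v \in S)%:R / #|S|%:R.

Fixpoint three_events (n : nat) (s : seq 'F_p) : seq (option nat * set T) :=
  if s is v :: s' then (Some n, eps n @^-1` [set v]) :: three_events n.+1 s'
  else [::].

Lemma three_eventsP n s e : e \in three_events n s ->
  exists j, (n <= j)%N /\ exists B, e = (Some j, eps j @^-1` B).
Proof.
elim: s n => //= v s IHs n; rewrite inE => /predU1P[->|/IHs[j [nj H]]].
- by exists n; split=> //; exists [set v].
- by exists j; split=> //; exact: ltnW.
Qed.

Lemma three_events_uniq n s : uniq (map fst (three_events n s)).
Proof.
elim: s n => //= v s IHs n; rewrite IHs andbT.
by apply/mapP => -[e /three_eventsP[j [nj [B ->]]]] /= [ej]; rewrite ej ltnn in nj.
Qed.

Lemma three_product_law x s :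
  pr P (X 0 @^-1` [set x] `&` noise_event eps 0 s)
  = pr P (X 0 @^-1` [set x]) * \prod_(v <- s) three_law v.
Proof.
pose L := (None, X 0%N @^-1` [set x]) :: three_events 0 s.
have LP e : e \in L -> three_noise (X 0) eps e.1 e.2 /\ measurable e.2.
  rewrite inE => /predU1P[->|/three_eventsP[j [_ [B ->]]]] /=.
  - by split; [exists [set x] | exact: (three_X0_rv chain)].
  - split; first by exists B.
    by apply: discrete_rv_measurable; exact: (three_eps_rv chain).
have uniq_L : uniq (map fst L).
  rewrite /L /= three_events_uniq andbT.
  by apply/mapP=> -[e /three_eventsP[j [_ [B ->]]]].
have := pr_independent (three_indep chain) uniq_L (fun e eL => (LP e eL).1)
  (fun e eL => (LP e eL).2).
rewrite /L !big_cons /= => H.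
have -> : noise_event eps 0 s = \big[setI/setT]_(e <- three_events 0 s) e.2.
  elim: s 0%N {L LP uniq_L H} => [|v s IHs] n /=; first by rewrite big_nil.
  by rewrite big_cons -IHs.
rewrite H; congr (_ * _).
elim: s 0%N {L LP uniq_L H} => [|v s IHs] n /=; first by rewrite !big_nil.
by rewrite !big_cons -(IHs n.+1) /= (pr_uniform _ (three_eps_unif chain n)).
Qed.

Lemma three_transition h : gamma != 1 -> gamma^-1 != gamma ->
  transition three_step_fun three_law h = three_op alpha beta gamma h.
Proof.
move=> gamma1 gamma2; apply/funext => x; rewrite /transition sum_indicator.
have gammaV1 : 1 != gamma^-1 by rewrite eq_sym invr_eq1.
rewrite /S (finset.setUC [set 1; _]%SET) big_setU1; last first.
  by rewrite !inE negb_or gamma1 eq_sym.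
rewrite big_setU1 ?inE //= big_set1 cardsU1 !inE negb_or gamma1 eq_sym gamma2.
by rewrite cards2 gammaV1 /three_op /three_step_fun mulr1 /=; field.
Qed.

Lemma three_tv_le (theta B : R) (n : nat) : gamma != 1 -> gamma^-1 != gamma ->
  (forall h : 'F_p -> R, \sum_(x | x != 0) h x = 0 ->
     normsq (iter n (three_op alpha beta gamma) h) <= theta * normsq h) ->
  0 <= theta -> 0 <= B -> theta * p%:R <= B ^+ 2 ->
  tv_unif P (X n) <= B.
Proof.
move=> gamma1 gamma2 decay.
apply: (@tv_unif_le _ _ _ P p _ three_step_fun three_law X eps) => //.
- exact: (three_X0_rv chain).
- exact: (three_eps_rv chain).
- exact: (three_step chain).
- exact: three_product_law.
- exact: (three_X0_neq0 chain).
- rewrite (_ : transition _ _ = three_op alpha beta gamma) //.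
  by apply/funext => h; exact: three_transition.
Qed.

End Three.
End Instances.

(** * Choice of the parameters *)

Section Asymptotics.
Variable R : realType.

Lemma ln2_ge_half : 2^-1 <= ln 2 :> R.
Proof.
have := @le_ln1Dx R (- 2^-1) _; rewrite (_ : 1 - 2^-1 = 2^-1); last by field.
by rewrite lnV ?posrE // lerN2; apply; lra.
Qed.

(** In other words, (log2 p) ^ log_ratio p = p. *)
Lemma log_ratioE p : (2 < p)%N ->
  log_ratio R p * ln (log2 (p%:R : R)) = ln p%:R.
Proof.
move=> p2; have ln2 : 0 < ln 2 :> R by rewrite ln_gt0 // ltr1n.
have lnp : ln 2 < ln p%:R :> R by rewrite ltr_ln ?posrE ?ltr0n ?ltr_nat // ltnW // ltnW.
have lnl : 0 < ln (log2 (p%:R : R)) by rewrite ln_gt0 // ltr_pdivlMr // mul1r.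
rewrite /log_ratio /log2; field; rewrite !gt_eqF //.
Qed.

(** For l = log2 p and s = ln l, the exponent eps * L is eps (ln 2) l / s.  It
    exceeds ln (D l^m) <= (m + 1) s because l = exp s >= s^3 / 6. *)
Lemma expR_log_ratio_dominates (eps D : R) (m : nat) : 0 < eps ->
  exists p0, forall p, (p0 <= p)%N ->
    D * log2 (p%:R : R) ^+ m <= expR (eps * log_ratio R p).
Proof.
move=> eps0.
pose s0 : R := Num.max (Num.max 1 D) (12 * (m%:R + 1) / eps).
have ln2 : 0 < ln 2 :> R by rewrite ln_gt0 // ltr1n.
exists (Num.truncn (expR (ln 2 * expR s0))).+3 => p le_p.
have p2 : (2 < p)%N by exact: leq_trans le_p.
have lt_p : expR (ln 2 * expR s0) < p%:R.
  apply: lt_le_trans (truncnS_gt _) _; rewrite ler_nat.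
  by apply: leq_trans le_p; exact: ltnW.
have p_gt0 : 0 < p%:R :> R by rewrite ltr0n ltnW // ltnW.
have lt_l : expR s0 < log2 (p%:R : R).
  by rewrite ltr_pdivlMr // mulrC -ltr_expR lnK.
have l_gt0 : 0 < log2 (p%:R : R) by apply: lt_trans lt_l; exact: expR_gt0.
have ratioE := log_ratioE p2.
have lnpE : ln p%:R = ln 2 * log2 (p%:R : R) by rewrite mulrC divfK // gt_eqF.
rewrite lnpE in ratioE.
move: ratioE l_gt0 lt_l; move: (log2 _) (log_ratio _ _) => l L ratioE l_gt0 lt_l.
pose s := ln l; have lE : l = expR s by rewrite lnK.
have s0s : s0 < s by rewrite -ltr_expR -lE.
have : s0 <= s by exact: ltW.
rewrite !ge_max => /andP[/andP[s1 sD]].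
rewrite ler_pdivrMr // => sm.
have sq : s ^+ 3 <= 6 * l.
  have := @expR_ge1Dxn R s 2; rewrite -lE => /(_ (le_trans ler01 s1)).
  rewrite -[(3`!)%:R]/(6%:R); lra.
have leD : D <= l.
  by apply: le_trans sD _; apply: ltW; exact: ln_sublinear.
have sgt0 : 0 < s by exact: lt_le_trans s1.
apply: (@le_trans _ _ (l ^+ m.+1)).
  by rewrite exprS ler_pM2r // exprn_gt0.
rewrite lE -expRM_natl ler_expR.
rewrite -(ler_pM2r sgt0) -[X in _ <= X]mulrA ratioE.
have h2 := ln2_ge_half.
rewrite -natr1.
have : (m%:R + 1) * s ^+ 2 <= eps * (s ^+ 3 / 12).
  have : 0 <= s ^+ 2 * (s * eps - 12 * (m%:R + 1)).
    by rewrite mulr_ge0 ?sqr_ge0 // subr_ge0.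
  rewrite exprS; lra.
have : eps * (s ^+ 3 / 12) <= eps * (ln 2 * l).
  rewrite ler_pM2l //; nra.
lra.
Qed.

(** Here N0 is the bit length of p, k is a constant of order 1 + 1/C0, r is the
    least integer above L/k, Q = r N0^k and N = 2 N0.  Then 3^r <= exp (2L/k + 2),
    and the Poincare constant is at most 3^(5r) times a power of log p. *)
Lemma walk_parameters (C0 c0 : R) : 0 < C0 -> 0 < c0 ->
  exists p0, forall p, (p0 <= p)%N -> exists Q r N : nat,
  [/\ [/\ (3 < p)%N, (0 < Q)%N & (r`! * p < Q ^ r)%N],
      (p * 2 ^ N < 3 ^ N)%N,
      2 * (3 ^ r)%:R < expR (C0 * log_ratio R p) &
      448 * poincare_const R Q r N * (2 + ln p%:R / c0)
        <= expR (log_ratio R p)].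
Proof.
move=> C00 c00.
have [k [k20 kC0]] : exists k : nat, 20 <= k%:R :> R /\ 4 <= C0 * k%:R.
  exists (20 + (Num.truncn (4 / C0)).+1)%N; split; first by rewrite ler_nat leq_addr.
  rewrite mulrC -ler_pdivrMr //; apply: ltW; apply: lt_le_trans (truncnS_gt _) _.
  by rewrite ler_nat leq_addl.
have k_gt0 : 0 < k%:R :> R by apply: lt_le_trans k20.
pose D : R := 448 * (64 * 2 ^+ (2 * k + 3)) * expR 10 * (2 + c0^-1).
have [p1 H1] := @expR_log_ratio_dominates 2^-1 D (2 * k + 4) ltac:(lra).
have [p2 H2] := @expR_log_ratio_dominates (C0 / 2) (2 * expR 2 + 1) 0 ltac:(lra).
exists (maxn 4 (maxn p1 p2)) => p; rewrite !geq_max => /and3P[p4 /H1 {}H1 /H2 {}H2].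
have p_gt2 : (2 < p)%N by exact: ltnW.
have p_gt0 : (0 < p)%N by exact: ltnW (ltnW _).
have pR_gt0 : 0 < p%:R :> R by rewrite ltr0n.
set l := log2 (p%:R : R) in H1 H2 *; set L := log_ratio R p in H1 H2 *.
have ln2 : 0 < ln 2 :> R by rewrite ln_gt0 // ltr1n.
have lnpE : ln p%:R = ln 2 * l by rewrite mulrC divfK // gt_eqF.
have l_gt1 : 1 < l.
  by rewrite ltr_pdivlMr // mul1r ltr_ln ?posrE // ltr_nat.
have l_gt0 : 0 < l by exact: lt_trans l_gt1.
have lnl_gt0 : 0 < ln l by exact: ln_gt0.
have LE : L * ln l = ln p%:R by exact: log_ratioE.
have L_gt0 : 0 < L by rewrite -(pmulr_lgt0 _ lnl_gt0) LE lnpE mulr_gt0.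
pose N0 := (trunc_log 2 p).+1.
have /andP[le_N0 lt_N0] := trunc_log_bounds (isT : (1 < 2)%N) p_gt0.
rewrite -/N0 in lt_N0.
have l_lt_N0 : l < N0%:R.
  rewrite ltr_pdivrMr // mulr_natl -lnXn // ltr_ln ?posrE ?exprn_gt0 //.
  by rewrite -natrX ltr_nat.
have N0_le_2l : N0%:R <= 2 * l.
  have : (trunc_log 2 p)%:R <= l.
    rewrite ler_pdivlMr // mulr_natl -lnXn // ler_ln ?posrE ?exprn_gt0 //.
    by rewrite -natrX ler_nat.
  by rewrite /N0 -natr1; lra.
pose r := (Num.truncn (L / k%:R)).+1.
have Lk_ge0 : 0 <= L / k%:R by rewrite divr_ge0 ?ltW.
have /andP[r_le lt_r] := truncn_itv Lk_ge0.
rewrite -/r in lt_r.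
have {}r_le : r%:R <= L / k%:R + 1 by rewrite /r -natr1 lerD2r.
have r_gt0 : (0 < r)%N by [].
have N0_gt0 : (0 < N0)%N by [].
clearbody r N0 l L.
have expr3 : (3 ^ r)%:R <= expR (2 * (L / k%:R + 1)).
  apply: (@le_trans _ _ (expR (r%:R * 2))); last by rewrite ler_expR; lra.
  rewrite natrX expRM_natl; apply: lerXn2r; rewrite ?nnegrE ?expR_ge0 //.
  by apply: le_trans (expR_ge1Dx 2); lra.
exists (r * N0 ^ k)%N, r, (2 * N0)%N.
split.
- split=> //; first by rewrite muln_gt0 r_gt0 expn_gt0 N0_gt0.
  have fact_le : (r`! <= r ^ r)%N.
    rewrite fact_prod -[X in (_ <= _ ^ X)%N](card_ord r) -prod_nat_const.
    rewrite big_add1 /= big_mkord; apply: leq_prod => i _; exact: ltn_ord.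
  rewrite expnMn -expnM; apply: leq_ltn_trans (leq_mul fact_le (leqnn p)) _.
  rewrite ltn_pmul2l ?expn_gt0 ?r_gt0 // -(ltr_nat R) natrX.
  rewrite -ltr_ln ?posrE ?exprn_gt0 ?ltr0n // lnXn ?ltr0n // -LE -[ltRHS]mulr_natl.
  rewrite ltr_pdivrMr // in lt_r.
  apply: (@lt_trans _ _ ((k * r)%:R * ln l)).
    by rewrite ltr_pM2r // natrM mulrC.
  have k_gt0' : (0 < k)%N by rewrite -(ltr0n R).
  by rewrite ltr_pM2l ?ltr0n ?muln_gt0 ?k_gt0' // ltr_ln ?posrE // ltr0n.
- (* p < 2^N0 and 2^N0 4^N0 < 9^N0 *)
  rewrite !expnM; apply: (@leq_trans (2 ^ N0 * (2 ^ 2) ^ N0)).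
    by rewrite ltn_pmul2r ?expn_gt0.
  by rewrite -expnMn leq_exp2r.
- apply: (@le_lt_trans _ _ (2 * expR (2 * (L / k%:R + 1)))).
    by rewrite ler_pM2l.
  have : 2 * (L / k%:R + 1) <= C0 / 2 * L + 2.
    have : L / k%:R <= C0 / 4 * L.
      by rewrite ler_pdivrMr // mulrAC; rewrite -[leLHS]mul1r ler_pM2r //; lra.
    lra.
  rewrite -ler_expR expRD => h3.
  have h4 : 2 * expR 2 + 1 <= expR (C0 / 2 * L) by move: H2; rewrite expr0 mulr1.
  have -> : C0 * L = C0 / 2 * L + C0 / 2 * L by field.
  rewrite expRD; have := expR_gt0 (C0 / 2 * L); nra.
rewrite /poincare_const.
set t : R := (3 ^ r)%:R in expr3 *.
have t_ge1 : 1 <= t by rewrite ler1n expn_gt0.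
have t_ge0 : 0 <= t by exact: le_trans t_ge1.
have r_le_t : r%:R <= t by rewrite ler_nat ltnW // ltn_expl.
set a : R := N0%:R in l_lt_N0 N0_le_2l.
have a_ge1 : 1 <= a by rewrite ler1n.
have a_ge0 : 0 <= a by exact: le_trans a_ge1.
have Q_le : (r * N0 ^ k)%:R <= t * a ^+ k.
  by rewrite natrM natrX ler_wpM2r // exprn_ge0.
have M_le : (2 * N0 * 3 ^ r + 2)%:R <= 4 * (a * t).
  rewrite natrD !natrM -/t -/a; nra.
have K_le : (r * N0 ^ k)%:R ^+ 2 * (2 * N0 * 3 ^ r + 2)%:R ^+ 3
    <= t ^+ 5 * (64 * 2 ^+ (2 * k + 3)) * l ^+ (2 * k + 3).
  apply: (@le_trans _ _ ((t * a ^+ k) ^+ 2 * (4 * (a * t)) ^+ 3)).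
    apply: ler_pM; rewrite ?exprn_ge0 //;
    by apply: lerXn2r; rewrite ?nnegrE ?mulr_ge0 ?exprn_ge0.
  have -> : (t * a ^+ k) ^+ 2 * (4 * (a * t)) ^+ 3 = t ^+ 5 * 64 * a ^+ (2 * k + 3).
    by rewrite exprD (mulnC 2) exprM; ring.
  rewrite -[leRHS]mulrA -[X in _ <= _ * X]mulrA -exprMn [leRHS]mulrA ler_wpM2l //.
    by rewrite mulr_ge0 // exprn_ge0.
  by apply: lerXn2r; rewrite ?nnegrE //; lra.
have t5 : t ^+ 5 <= expR 10 * expR (2^-1 * L).
  apply: (@le_trans _ _ (expR (2 * (L / k%:R + 1)) ^+ 5)).
    by apply: lerXn2r; rewrite ?nnegrE ?expR_ge0.
  rewrite -expRM_natl -expRD ler_expR.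
  have : L / k%:R <= L / 20.
    by rewrite ler_pdivrMr // mulrAC ler_pdivlMr // ler_pM2l.
  lra.
have lnp_le : 2 + ln p%:R / c0 <= (2 + c0^-1) * l.
  have : ln p%:R / c0 <= c0^-1 * l.
    rewrite mulrC ler_pM2l ?invr_gt0 // lnpE; apply: ler_piMl; first exact: ltW.
    by have := @le_ln1Dx R 1; rewrite (_ : 1 + 1 = 2) //; apply; lra.
  lra.
have K_ge0 : 0 <= (r * N0 ^ k)%:R ^+ 2 * (2 * N0 * 3 ^ r + 2)%:R ^+ 3 :> R.
  by rewrite mulr_ge0 // exprn_ge0.
have {K_le} : (r * N0 ^ k)%:R ^+ 2 * (2 * N0 * 3 ^ r + 2)%:R ^+ 3
    <= expR 10 * expR (2^-1 * L) * (64 * 2 ^+ (2 * k + 3)) * l ^+ (2 * k + 3).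
  apply: le_trans K_le _; apply: ler_wpM2r; first by apply: exprn_ge0; exact: ltW.
  by apply: ler_wpM2r => //; apply: mulr_ge0 => //; exact: exprn_ge0.
have lnp_ge0 : 0 <= 2 + ln p%:R / c0.
  apply: addr_ge0 => //; apply: divr_ge0; last exact: ltW.
  by rewrite lnpE; apply: mulr_ge0; exact: ltW.
rewrite addnS exprS /D in H1; move: K_ge0 lnp_ge0 lnp_le H1.
move: (_ * _ ^+ 3) (2 + _ / c0) (64 * _) (l ^+ _) => K P c q K0 P0 leP H1 leK.
rewrite [X in _ <= expR X](_ : L = 2^-1 * L + 2^-1 * L); last by field.
rewrite expRD; apply: le_trans (ler_wpM2r (expR_ge0 _) H1).
rewrite -mulrA; apply: le_trans (ler_wpM2l (ler0n R 448) (ler_pM K0 P0 leK leP)) _.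
by rewrite le_eqVlt; apply/orP; left; apply/eqP; ring.
Qed.
End Asymptotics.

(** * Conclusion *)

Lemma unit_expr_neq1 (F : finFieldType) (gamma : {unit F}) (m : nat) :
  (0 < m)%N -> (m < #[gamma]%g)%N -> val gamma ^+ m != 1.
Proof.
move=> m_gt0 lt_m; apply: contraL lt_m => /eqP gamma_m.
have : (gamma ^+ m)%g = 1%g by apply: val_inj; rewrite FinRing.val_unitX.
move/eqP; rewrite -order_dvdn -leqNgt; exact: dvdn_leq.
Qed.

(** From (1 - 1/K)^m <= exp (-m/K) with m = n/2 >= n/4. *)
Lemma contraction_power_le (R : realType) (K c q : R) (n : nat) :
  1 <= K -> (1 < n)%N -> 0 < q -> 4 * K * (2 * c + ln q) <= n%:R ->
  (1 - K^-1) ^+ n./2 * q <= expR (- c) ^+ 2.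
Proof.
move=> K1 n1 q0 le_n; have K0 : 0 < K by exact: lt_le_trans K1.
have n2 : n%:R <= 4 * (n./2)%:R :> R by rewrite -natrM ler_nat; lia.
have : 4 * (K * (2 * c + ln q)) <= 4 * (n./2)%:R by apply: le_trans n2; rewrite mulrA.
rewrite ler_pM2l // mulrC -ler_pdivlMr // => {n2 le_n}le_half.
apply: (@le_trans _ _ (expR (- ((n./2)%:R / K)) * q)).
  rewrite ler_pM2r // -mulrN expRM_natl; apply: lerXn2r.
  - by rewrite nnegrE subr_ge0 invf_le1.
  - by rewrite nnegrE expR_ge0.
  - exact: expR_ge1Dx.
by rewrite -{1}(lnK (_ : q \is Num.pos)) // -expRD -expRM_natl ler_expR; lra.
Qed.

Theorem theorem12 (R : realType) :
  exists2 kappa : R, 0 < kappa &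
  forall (C0 c0 : R), 0 < C0 -> 0 < c0 ->
  exists p0 : nat, forall p : nat, prime p -> (p0 <= p)%N ->
  forall (alpha beta : 'F_p) (gamma : {unit 'F_p}),
    alpha != 0 -> beta != 0 ->
    expR (C0 * log_ratio R p) <= (#[gamma]%g)%:R ->
  forall (c : R) (n : nat),
    c0 <= c -> n%:R = c * expR (log_ratio R p) ->
  forall (d : measure_display) (T : measurableType d) (P : probability T R),
    (forall (X eps : nat -> T -> 'F_p) (coin : nat -> T -> bool),
       lazy_chain P alpha beta (val gamma) X eps coin ->
       tv_unif P (X n) <= expR (- (kappa * c)))
    /\
    (forall (X eps : nat -> T -> 'F_p),
       three_chain P alpha beta (val gamma) X eps ->
       tv_unif P (X n) <= expR (- (kappa * c))).
Proof.
exists 1 => // C0 c0 C0_gt0 c0_gt0.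
have [p0 params] := walk_parameters C0_gt0 c0_gt0.
exists p0 => p p_pr /params[Q [r [N [[p_gt3 Q_gt0 ltQ] ltN lt_ord leK]]]].
move=> alpha beta gamma alpha0 beta0 ord_gamma c n le_c nE d T P.
rewrite mul1r; pose g := val gamma.
have g0 : g != 0 by rewrite -unitfE; exact: (valP gamma).
have ord_g2 m : (0 < m)%N -> (m <= 3 ^ r)%N -> (g ^+ 2) ^+ m != 1.
  move=> m_gt0 le_m; rewrite -exprM unit_expr_neq1 ?muln_gt0 //.
  rewrite -(ltr_nat R); apply: lt_le_trans ord_gamma; apply: le_lt_trans lt_ord.
  by rewrite -natrM ler_nat leq_mul2l.
have g2_neq1 : g ^+ 2 != 1 by rewrite -[_ ^+ 2]expr1 ord_g2 // expn_gt0.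
have gV_neq : g^-1 != g.
  by apply: contraNneq g2_neq1 => eq_g; rewrite expr2 -{1}eq_g mulVf.
have g_neq1 : g != 1 by apply: contraNneq g2_neq1 => ->; rewrite expr1n.
pose K0 := poincare_const R Q r N; pose K := 112 * K0.
have K0_ge1 : 1 <= K0.
  by rewrite mulr_ege1 // exprn_ege1 // ler1n // addn2.
have K_ge1 : 1 <= K by rewrite /K; lra.
have K_gt0 : 0 < K by exact: lt_le_trans K_ge1.
have K0_ge0 : 0 <= K0 by exact: le_trans K0_ge1.
have theta_ge0 : 0 <= 1 - K^-1 by rewrite subr_ge0 invf_le1.
(* a Poincare inequality for the loss of norm is a contraction *)
have contract (x y : R) : x <= K * (x - y) -> y <= (1 - K^-1) * x.
  rewrite mulrC -ler_pdivrMr // => le_x; rewrite mulrBl mul1r mulrC; lra.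
have poincare h := normsq_le_dilation_energy (R := R) (h := h)
  p_pr p_gt3 ltQ ltN ord_g2 alpha0 beta0 g0.
have lnp_gt0 : 0 < ln p%:R :> R by rewrite ln_gt0 // ltr1n prime_gt1.
have c_gt0 : 0 < c by exact: lt_le_trans le_c.
have n_ge : 4 * K * (2 * c + ln p%:R) <= n%:R.
  rewrite nE; apply: le_trans (ler_wpM2l (ltW c_gt0) leK).
  rewrite -/K0 (_ : c * _ = 4 * K * (2 * c + ln p%:R * (c / c0))); last first.
    by rewrite /K; field; rewrite gt_eqF.
  apply: ler_wpM2l; first by rewrite mulr_ge0 // ltW.
  rewrite lerD2l; apply: ler_peMr; first exact: ltW.
  by rewrite ler_pdivlMr // mul1r.
have n_gt1 : (1 < n)%N.
  rewrite -(ltr_nat R); apply: lt_le_trans n_ge.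
  have : 2^-1 <= ln p%:R :> R.
    apply: le_trans (ln2_ge_half R) _; rewrite ler_ln ?posrE ?ltr0n ?prime_gt0 //.
    by rewrite ler_nat prime_gt1.
  rewrite /K; nra.
have final : (1 - K^-1) ^+ n./2 * p%:R <= expR (- c) ^+ 2.
  by apply: contraction_power_le => //; rewrite ltr0n prime_gt0.
split=> [X eps coin chain | X eps chain].
- apply: (lazy_tv_le p_pr chain gV_neq _
    (exprn_ge0 _ theta_ge0) (expR_ge0 _) final).
  move=> h h0; apply: normsq_iter_le => // [k|k|k k0].
  + exact: sum_lazy_op.
  + exact: normsq_lazy_op_le.
  + apply: le_trans (normsq_lazy_op_le _ _ _ _) _ => //.
    apply: contract; rewrite /K; exact: lazy_op_contraction.
- apply: (three_tv_le p_pr chain g_neq1 gV_neq _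
    (exprn_ge0 _ theta_ge0) (expR_ge0 _) final).
  move=> h h0; apply: normsq_iter_le => // [k|k|k k0].
  + exact: sum_three_op.
  + exact: normsq_three_op_le.
  + apply: contract; rewrite /K; exact: three_op_contraction.
Qed.
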